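(* Consider the $\beta$-biased exclusion process on $\{1,2,\ldots,n\}$ with $k$ particles, where $\beta>0$, and write $t_{\rm mix}=t_{\rm mix}(1/4)$ for its mixing time. Assume that $k/n\to\rho\le 1/2$. Then: (i) if $n\beta\le 1$, then $t_{\rm mix}\asymp n^3\log n$; (ii) if $1\le n\beta\le \log n$, then $t_{\rm mix}\asymp \dfrac{n\log n}{\beta^2}$; (iii) if $n\beta>\log n$, then $t_{\rm mix}\asymp \dfrac{n^2}{\beta}$. Here $a_n\asymp b_n$ means that there exist constants $0<c_1,c_2<\infty$, not depending on $\beta$, so that $c_1\le a_n/b_n\le c_2$.
   Context: The $\beta$-biased exclusion process on $\{1,\ldots,n\}$ with $k$ particles is the discrete-time Markov chain on the set of configurations $\sigma\in\{0,1\}^n$ with exactly $k$ ones (particles), with the following transitions. At each step choose one of the $n-1$ edges $\{i,i+1\}$ of the path uniformly at random. If both endpoints are occupied or both are vacant, do nothing. If exactly one endpoint is occupied, place the particle on the right vertex $i+1$ with probability $p=(1+\beta)/2$ and on the left vertex $i$ with probability $q=(1-\beta)/2$. This chain is reversible and ergodic with a unique stationary distribution $\pi$. The bias $\beta=\beta_n$ and the number of particles $k=k_n$ may depend on $n$. The mixing time is $$t_{\rm mix}(\varepsilon)=\min\{t\ge 0:\ \max_{\sigma}\|\mathbf P_\sigma(X_t\in\cdot)-\pi\|_{\rm TV}<\varepsilon\}.$$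
   Formalization: The limiting density is assumed positive, 0 < ρ ≤ 1/2 (for ρ = 0 the claim fails, e.g. k = 1 with nβ ≤ 1 gives order n^3); also β < 1, as ergodicity requires, and the bounds hold for all sufficiently large n, uniformly in β. *)

(* Defs.v *)
From HB Require Import structures.
From mathcomp Require Import all_boot all_order all_algebra.
From mathcomp Require Import all_classical all_reals all_analysis.

Set Implicit Arguments.
Unset Strict Implicit.
Unset Printing Implicit Defensive.

Import Order.TTheory GRing.Theory Num.Theory.
Import numFieldNormedType.Exports.

Local Open Scope classical_set_scope.
Local Open Scope ring_scope.

Definition step (R : realType) (T : finType) (P : T -> T -> R) (mu : T -> R) :
  T -> R := fun y => \sum_(x : T) mu x * P x y.

Definition law (R : realType) (T : finType) (P : T -> T -> R) (x : T)
  (t : nat) : T -> R := iter t (step P) (fun y => (y == x)%:R).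

Definition is_stationary (R : realType) (T : finType) (P : T -> T -> R)
    (pi : T -> R) : Prop :=
  [/\ forall x, 0 <= pi x, \sum_(x : T) pi x = 1 & step P pi = pi].

(* Meaningful when P has exactly one stationary distribution; it is the zero
   function when there is none. *)
Definition stationary (R : realType) (T : finType) (P : T -> T -> R) : T -> R :=
  xget (fun=> 0) [set pi : T -> R | is_stationary P pi].

Definition tv_dist (R : realType) (T : finType) (mu nu : T -> R) : R :=
  \big[Num.max/0]_(A : {set T}) `|\sum_(x in A) mu x - \sum_(x in A) nu x|.

Definition max_dist (R : realType) (T : finType) (P : T -> T -> R) (t : nat) :
  R := \big[Num.max/0]_(x : T) tv_dist (law P x t) (stationary P).

(* The value 0 of the second branch (the chain never gets eps-close to
   stationarity) is a default: no positive lower bound can hold there. *)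
Definition tmix (R : realType) (T : finType) (P : T -> T -> R) (eps : R) : nat :=
  if pselect (exists t, max_dist P t < eps) is left ex_t then ex_minn ex_t
  else 0%N.

(* The vertices 1, ..., n are represented by 0, ..., n - 1. *)
Definition config (n k : nat) : Type :=
  {s : {ffun 'I_n -> bool} | (\sum_(x < n) s x)%N == k}.

Definition put (n : nat) (x y : 'I_n) (a b : bool) (s : {ffun 'I_n -> bool}) :
    {ffun 'I_n -> bool} :=
  [ffun z => if z == x then a else if z == y then b else s z].

Definition edge_update (R : realType) (n : nat) (beta : R) (x y : 'I_n)
    (s s' : {ffun 'I_n -> bool}) : R :=
  if s x == s y then (s' == s)%:R
  else (1 + beta) / 2 * (s' == put x y false true s)%:R
     + (1 - beta) / 2 * (s' == put x y true false s)%:R.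

(* The transition rule conserves the number of particles, so reading it on the
   underlying 0/1 sequences gives a kernel on configurations with k particles.
   The sum ranges over the n - 1 edges {x, x + 1}. *)
Definition exclusion (R : realType) (n k : nat) (beta : R)
    (s s' : config n k) : R :=
  (n.-1%:R)^-1 *
  \sum_(e : 'I_n * 'I_n | (e.2 : nat) == e.1.+1)
     edge_update beta e.1 e.2 (val s) (val s').
Arguments exclusion {R} n k beta s s'.

Definition exclusion_tmix (R : realType) (n k : nat) (beta : R) : nat :=
  tmix (exclusion n k beta) (1 / 4).

(* a ≍ b over the regime D: the constants, and the rank from which the bounds
   hold, are uniform in the bias. *)
Definition asymp_on (R : realType) (D : nat -> R -> Prop) (a b : nat -> R -> R) :
    Prop :=
  exists c1 c2 : R, [/\ 0 < c1, 0 < c2 &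
    \forall n \near \oo, forall beta : R, D n beta ->
      c1 <= a n beta / b n beta <= c2].

(* Main.v *)
Require Import Defs.
From HB Require Import structures.
From mathcomp Require Import all_boot all_order all_algebra.
From mathcomp Require Import all_classical all_reals all_analysis.
From mathcomp Require Import zify ring lra.
Import Order.TTheory GRing.Theory Num.Theory.
Import numFieldNormedType.Exports.
Local Open Scope classical_set_scope.
Local Open Scope ring_scope.

(** Upper bound: dual path coupling. A function whose variation under moving one
    particle from [j] to [j + 1] is at most [L * j (n - j) * alpha ^ h], with [h]
    the height (holes minus particles on the left), keeps this property with [L]
    multiplied by [1 - delta / (n - 1)] after one step, where
    [delta = beta^2 / 2 + 1 / n^2]. As the weights vary at most by a factor
    [n^2 * exp (4 beta n)], the mixing time is
    [O (n (log n + beta n) / (beta^2 + 1 / n^2))], which is the right order in the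
    three regimes.

    Lower bounds: the sum of the positions of the particles moves at speed
    [O (beta + 1 / n)] and has to travel a distance of order [n^2], hence
    [n^2 / beta] when [n beta >= 1]; this settles (iii), and (ii) when
    [n beta >= c log n]. For smaller biases Wilson's method is applied to
    [\sum_j (q/p)^(j/2) sin (pi j / n) ((p/q)^(N_j) - g_j)], where [N_j] is the
    number of particles among the first [j] sites: the Cole-Hopf transform
    [(p/q)^(N_j)] satisfies a closed linear evolution equation, so this is an exact
    eigenfunction. *)

Set Implicit Arguments.
Unset Strict Implicit.
Unset Printing Implicit Defensive.

(** * Finite Markov chains: duality, total variation and a second-moment bound *)

Section FiniteChain.
Variables (R : realType) (T : finType) (P : T -> T -> R).

(** The constants must survive both [beta -> 0] and [n beta -> oo]. In the upper bound the two
    factors of the weight serve opposite ends: [alpha ^ h] balances the jump rates and yields the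
    [beta ^ 2 / 2] of [delta], while the parabola, with second difference [-2], yields the
    [1 / n ^ 2] that remains when the bias vanishes. The contraction also shows that the stationary
    law, given only as a chosen one, has the same expectations as the Gibbs measure. In Wilson's
    method both the initial value of the eigenfunction and its largest jump carry a factor
    [p/q - 1], which cancels, so that nothing degenerates as [beta -> 0]. The remaining powers of
    [p/q] cost [exp (18 beta n)], at most [sqrt n] when [36 n beta <= ln n]. Beyond this threshold
    the ballistic time [n ^ 2 / beta = n (n beta) / beta ^ 2] is already at least of the order
    [n ln n / beta ^ 2]. *)

Definition expect (mu f : T -> R) : R := \sum_x mu x * f x.

Definition evolve (f : T -> R) : T -> R := fun x => \sum_y P x y * f y.

Lemma expect_step (mu f : T -> R) : expect (step P mu) f = expect mu (evolve f).
Proof.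
rewrite /expect /step /evolve.
under eq_bigr do rewrite mulr_suml.
rewrite exchange_big /=; apply: eq_bigr => x _.
by rewrite mulr_sumr; apply: eq_bigr => y _; rewrite mulrA.
Qed.

Lemma expect_law (x : T) (t : nat) (f : T -> R) :
  expect (law P x t) f = iter t evolve f x.
Proof.
rewrite /law; elim: t f => [|t IHt] f; last by rewrite iterS expect_step IHt -iterSr.
rewrite /expect /= (bigD1 x) //= eqxx mul1r big1 ?addr0 // => y /negbTE ->.
by rewrite mul0r.
Qed.

Lemma expectD mu (f g : T -> R) :
  expect mu (fun x => f x + g x) = expect mu f + expect mu g.
Proof. by rewrite -big_split; apply: eq_bigr => x _; rewrite mulrDr. Qed.

Lemma expectZ mu (a : R) (f : T -> R) :
  expect mu (fun x => a * f x) = a * expect mu f.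
Proof. by rewrite mulr_sumr; apply: eq_bigr => x _; rewrite mulrCA. Qed.

Lemma expect_cst mu (a : R) : \sum_x mu x = 1 -> expect mu (fun=> a) = a.
Proof. by move=> mu1; rewrite /expect -mulr_suml mu1 mul1r. Qed.

Lemma le_expect mu (f g : T -> R) : (forall x, 0 <= mu x) ->
  (forall x, f x <= g x) -> expect mu f <= expect mu g.
Proof. by move=> mu0 fg; apply: ler_sum => x _; apply: ler_wpM2l. Qed.

Lemma expect_indic mu (A : {set T}) :
  expect mu (fun x => (x \in A)%:R) = \sum_(x in A) mu x.
Proof.
rewrite /expect [RHS]big_mkcond /=; apply: eq_bigr => x _.
by case: (x \in A); rewrite ?mulr1 ?mulr0.
Qed.

Lemma le_tv_dist (mu nu : T -> R) (A : {set T}) :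
  `|\sum_(x in A) mu x - \sum_(x in A) nu x| <= tv_dist mu nu.
Proof. by apply: (@le_bigmax _ _ _ _ (fun A : {set T} => `|_ - _|)). Qed.

Lemma tv_dist_le (mu nu : T -> R) (d : R) : 0 <= d ->
  (forall A : {set T}, `|\sum_(x in A) mu x - \sum_(x in A) nu x| <= d) ->
  tv_dist mu nu <= d.
Proof. by move=> d0 dA; apply: bigmax_le. Qed.

(* The maximum over sets in [tv_dist] is attained at [A = {mu > nu}]. *)
Lemma expect_tv_dist (mu nu f : T -> R) (M : R) : 0 <= M ->
  (forall x, 0 <= f x <= M) -> expect mu f - expect nu f <= M * tv_dist mu nu.
Proof.
move=> M0 fM; pose A := [set x | nu x < mu x]%SET.
have -> : expect mu f - expect nu f = \sum_x (mu x - nu x) * f x.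
  by rewrite -sumrB; apply: eq_bigr => x _; rewrite mulrBl.
apply: (@le_trans _ _ (M * (\sum_(x in A) mu x - \sum_(x in A) nu x))); last first.
  by rewrite ler_wpM2l //; apply: le_trans (le_tv_dist _ _ A); rewrite ler_norm.
rewrite -sumrB mulr_sumr [leRHS]big_mkcond /=; apply: ler_sum => x _.
have /andP[f0 fxM] := fM x; rewrite inE.
case: ltP => munu; first by rewrite mulrC ler_wpM2r // subr_ge0 ltW.
by rewrite mulr_le0_ge0 // subr_le0.
Qed.

Lemma le_max_dist (x : T) (t : nat) :
  tv_dist (law P x t) (stationary P) <= max_dist P t.
Proof. by apply: (@le_bigmax _ _ _ _ (fun x => tv_dist (law P x t) _)). Qed.

Lemma stationaryP : (exists mu, is_stationary P mu) ->
  is_stationary P (stationary P).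
Proof. exact: xgetPex. Qed.

Hypothesis P_ge0 : forall x y, 0 <= P x y.
Hypothesis P_sum1 : forall x, \sum_y P x y = 1.

Lemma law_ge0 x t y : 0 <= law P x t y.
Proof.
rewrite /law; elim: t y => [|t IHt] y; first by rewrite ler0n.
by rewrite iterS; apply: sumr_ge0 => z _; rewrite mulr_ge0.
Qed.

Lemma law_sum1 x t : \sum_y law P x t y = 1.
Proof.
rewrite /law; elim: t => [|t IHt].
  by rewrite /= (bigD1 x) //= eqxx big1 ?addr0 // => y /negbTE ->.
rewrite -[RHS]IHt iterS /step exchange_big; apply: eq_bigr => y _ /=.
by rewrite -mulr_sumr P_sum1 mulr1.
Qed.

Lemma expect_stationary mu (f : T -> R) (t : nat) : is_stationary P mu ->
  expect mu (iter t evolve f) = expect mu f.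
Proof.
by case=> _ _ stat; elim: t => //= t IHt; rewrite -expect_step stat.
Qed.

Lemma iter_evolve_stationary mu (f : T -> R) (t : nat) (d : R) (x : T) :
  is_stationary P mu ->
  (forall y, `|iter t evolve f x - iter t evolve f y| <= d) ->
  `|iter t evolve f x - expect mu f| <= d.
Proof.
move=> stat dP; have [mu0 mu1 _] := stat.
rewrite -(expect_stationary f t stat) -[X in X - _](expect_cst _ mu1) -sumrB.
apply: le_trans (ler_norm_sum _ _ _) _; rewrite -(expect_cst d mu1).
by apply: ler_sum => y _; rewrite -mulrBr normrM ger0_norm // ler_wpM2l.
Qed.

(** By duality the probability of [A] at time [t] is the evolved indicator of [A], so its
    oscillation over starting points controls the distance to equilibrium; no coupled chains have to
    be built. *)
Lemma max_dist_le (t : nat) (d : R) : (exists mu, is_stationary P mu) -> 0 <= d ->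
  (forall (A : {set T}) x y,
     `|iter t evolve (fun z => (z \in A)%:R) x - iter t evolve (fun z => (z \in A)%:R) y|
       <= d) ->
  max_dist P t <= d.
Proof.
move=> /stationaryP stat d0 dP; apply: bigmax_le => // x _.
apply: tv_dist_le => // A; rewrite -!expect_indic expect_law.
by apply: iter_evolve_stationary => // y; apply: dP.
Qed.

Lemma tmix_le (eps : R) (t : nat) : max_dist P t < eps -> (tmix P eps <= t)%N.
Proof.
rewrite /tmix => dt; case: pselect => // ex_t.
by case: ex_minnP => m _; apply.
Qed.

Lemma max_dist_tmix (eps : R) : (exists t, max_dist P t < eps) ->
  max_dist P (tmix P eps) < eps.
Proof. by rewrite /tmix => ex_t; case: pselect => // e; case: ex_minnP. Qed.

(* The second-moment hypothesis keeps the variance of [Phi] below [r / (2 g)] at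
   all times; Chebyshev's inequality then separates the two laws as long as the
   squared mean is larger than the variance. *)
Lemma wilson (Phi : T -> R) (g r : R) (x : T) (t : nat) :
  (exists mu, is_stationary P mu) ->
  0 < g <= 1 / 2 -> 0 <= r ->
  (forall y, evolve Phi y = (1 - g) * Phi y) ->
  (forall y, evolve (fun z => Phi z ^+ 2) y <= (1 - g *+ 2) * Phi y ^+ 2 + r) ->
  max_dist P t < 1 / 4 ->
  ((1 - g) ^+ t * Phi x) ^+ 2 <= 6 * r / g.
Proof.
move=> /stationaryP stat /andP[g0 g1] r0 eigen second dt.
set pi := stationary P in stat *; have [pi0 pi1 pistep] := stat.
pose m := (1 - g) ^+ t * Phi x; rewrite -/m.
set v := r / (2 * g).
have gv : 2 * g * v = r by rewrite /v mulrC divfK // mulf_neq0 ?pnatr_eq0 ?gt_eqF.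
have v0 : 0 <= v by rewrite divr_ge0 ?mulr_ge0 // ltW.
have rv : 6 * r / g = 12 * v by rewrite -gv; field; rewrite gt_eqF.
have mean u : expect (law P x u) Phi = (1 - g) ^+ u * Phi x.
  rewrite expect_law; elim: u (x) => [|u IHu] z; first by rewrite mul1r.
  rewrite iterS /evolve; under eq_bigr do rewrite IHu mulrCA.
  by rewrite -mulr_sumr -/(evolve _ _) eigen exprSr mulrA.
have varlaw u :
    expect (law P x u) (fun z => Phi z ^+ 2) <= ((1 - g) ^+ u * Phi x) ^+ 2 + v.
  elim: u => [|u IHu]; first by rewrite expect_law mul1r lerDl.
  rewrite /law iterS expect_step -/(law P x u).
  apply: (le_trans (le_expect (law_ge0 x u) second)).
  rewrite expectD expectZ expect_cst ?law_sum1 //.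
  have : 0 <= 1 - g *+ 2 by rewrite mulr2n; lra.
  move/ler_wpM2l => /(_ _ _ IHu) h.
  rewrite [(1 - g) ^+ u.+1]exprS -mulrA; set a := _ * Phi x in h *.
  have : 0 <= (g * a) ^+ 2 by exact: sqr_ge0.
  rewrite mulr2n in h *; nra.
have varpi : expect pi (fun z => Phi z ^+ 2) <= v.
  have := le_expect pi0 second.
  rewrite -expect_step pistep expectD expectZ expect_cst // mulr2n => h.
  have : 2 * g * expect pi (fun z => Phi z ^+ 2) <= 2 * g * v by lra.
  by rewrite ler_pM2l // mulr_gt0.
rewrite rv; case: (ltrP 0 (m ^+ 2)) => [m0|]; last first.
  by move=> /le_trans; apply; rewrite mulr_ge0.
(* [A] is the event that [Phi], taken with the sign of [m], reaches at least half of [m]. The two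
   tail bounds below leave [m ^+ 2 - 8 v < m ^+ 2 / 4], whence the factor 12. *)
pose A := [set z | m ^+ 2 <= 2 * (m * Phi z)]%SET.
have piA : m ^+ 2 * \sum_(z in A) pi z <= 4 * v.
  rewrite -expect_indic -expectZ; apply: (@le_trans _ _ (4 * expect pi (fun z => Phi z ^+ 2))).
    rewrite -expectZ; apply: le_expect => // z; rewrite inE.
    case: (leP (m ^+ 2) (2 * (m * Phi z))) => h; last by rewrite mulr0n mulr0 mulr_ge0 // sqr_ge0.
    rewrite mulr1n mulr1; have : 0 <= (m - 2 * Phi z) ^+ 2 by exact: sqr_ge0.
    nra.
  by rewrite ler_wpM2l.
have lawA : m ^+ 2 * (1 - \sum_(z in A) law P x t z) <= 4 * v.
  rewrite -expect_indic -[X in X - _](@expect_cst (law P x t) 1) ?law_sum1 //.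
  have -> : forall mu, expect mu (fun=> 1) - expect mu (fun z => (z \in A)%:R) =
                       expect mu (fun z => 1 + (-1) * (z \in A)%:R).
    by move=> mu; rewrite expectD expectZ mulN1r.
  rewrite -expectZ.
  have -> : 4 * v = 4 * (m ^+ 2 + v) + (- 8 * m) * m + 4 * m ^+ 2 by ring.
  apply: (@le_trans _ _ (4 * expect (law P x t) (fun z => Phi z ^+ 2)
           + (- 8 * m) * expect (law P x t) Phi + 4 * m ^+ 2)); last first.
    by rewrite mean -/m !lerD2r ler_wpM2l // varlaw.
  rewrite -[4 * m ^+ 2](@expect_cst (law P x t)) ?law_sum1 //.
  rewrite -!expectZ -!expectD; apply: le_expect => [z|z]; first exact: law_ge0.
  rewrite inE; case: (leP (m ^+ 2) (2 * (m * Phi z))) => h.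
    by have : 0 <= (m - Phi z) ^+ 2; [exact: sqr_ge0 | rewrite mulr1n mulr1; nra].
  by have : 0 <= (m - 2 * Phi z) ^+ 2; [exact: sqr_ge0 | rewrite mulr0n mulr0; nra].
have : \sum_(z in A) law P x t z - \sum_(z in A) pi z < 1 / 4.
  apply: le_lt_trans dt; apply: le_trans (le_max_dist x t).
  by apply: le_trans (le_tv_dist _ _ A); rewrite ler_norm.
rewrite -(ltr_pM2l m0); set S1 := \sum_(z in A) law _ _ _ _ in lawA *.
set S2 := \sum_(z in A) _ in piA *; move=> h; nra.
Qed.

End FiniteChain.

(** * Height function of a configuration and local moves *)

Section Counting.
Variable n : nat.
Implicit Types (s : {ffun 'I_n -> bool}) (x y u v : 'I_n) (j : nat) (a b : bool).

Definition cnt s j : nat := (\sum_(i < n | (i < j)%N) s i)%N.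

Lemma cnt0 s : cnt s 0 = 0%N.
Proof. by rewrite /cnt big_pred0. Qed.

Lemma cnt_full s : cnt s n = (\sum_(i < n) s i)%N.
Proof. by apply: eq_bigl => i; rewrite ltn_ord. Qed.

Lemma cntS s x : cnt s x.+1 = (cnt s x + s x)%N.
Proof.
rewrite /cnt (bigD1 x) //= addnC; congr (_ + _)%N.
by apply: eq_bigl => i; rewrite ltnS ltn_neqAle andbC.
Qed.

Lemma cnt_edge s x y : y = x.+1 :> nat -> cnt s y = (cnt s x + s x)%N.
Proof. by move=> ->; rewrite cntS. Qed.

Lemma cnt_leq s j : (cnt s j <= j)%N.
Proof.
elim: j => [|j IHj]; first by rewrite cnt0.
case: (ltnP j n) => [jn|nj].
  by rewrite (cntS s (Ordinal jn)) -addn1 leq_add //= leq_b1.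
rewrite (leq_trans _ (leqW IHj)) // /cnt leq_eqVlt; apply/orP; left; apply/eqP.
by apply: eq_bigl => i; rewrite ltnS ltnW ?(leq_trans (ltn_ord i)).
Qed.

Lemma put_l x y a b s : put x y a b s x = a.
Proof. by rewrite ffunE eqxx. Qed.

Lemma put_r x y a b s : y != x -> put x y a b s y = b.
Proof. by move=> /negbTE yx; rewrite ffunE yx eqxx. Qed.

Lemma put_ne x y a b s z : z != x -> z != y -> put x y a b s z = s z.
Proof. by move=> /negbTE zx /negbTE zy; rewrite ffunE zx zy. Qed.

Lemma put_id x y s : put x y (s x) (s y) s = s.
Proof. by apply/ffunP => z; rewrite ffunE; do 2?case: eqP => [->|_]. Qed.

Lemma put_put x y a b a' b' s : put x y a b (put x y a' b' s) = put x y a b s.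
Proof. by apply/ffunP => z; rewrite !ffunE; do 2?case: eqP. Qed.

Lemma putC x y u v a b a' b' s : u != x -> u != y -> v != x -> v != y ->
  put u v a b (put x y a' b' s) = put x y a' b' (put u v a b s).
Proof.
move=> ux uy vx vy; apply/ffunP => z; rewrite !ffunE.
have [->|_] := eqVneq z u; first by rewrite (negbTE ux) (negbTE uy).
by have [->|_] := eqVneq z v; first by rewrite (negbTE vx) (negbTE vy).
Qed.

Lemma edge_neq x y : y = x.+1 :> nat -> y != x.
Proof. by move=> yx; rewrite -val_eqE /= yx eqn_leq ltnn. Qed.

Lemma cnt_put_low x y a b s j : y = x.+1 :> nat -> (j <= x)%N ->
  cnt (put x y a b s) j = cnt s j.
Proof.
move=> yx jx; apply: eq_bigr => z zj; rewrite put_ne // -val_eqE neq_ltn.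
  by rewrite (leq_trans zj jx).
by rewrite /= yx (leq_trans zj (leqW jx)).
Qed.

Lemma cnt_put x y a b s j : y = x.+1 :> nat -> (a + b = s x + s y)%N ->
  cnt (put x y a b s) j = if j == y then (cnt s x + a)%N else cnt s j.
Proof.
move=> yx ab; have neq := edge_neq yx.
have low i := cnt_put_low a b s yx (j := i).
have mid : cnt (put x y a b s) y = (cnt s x + a)%N.
  by rewrite (cnt_edge _ yx) low // put_l.
elim: j => [|j IHj]; first by rewrite !cnt0 yx.
case: eqP => [->//|/eqP jy]; case: (leqP j.+1 x) => [/low//|xj].
have yj : (y <= j)%N by move: jy; rewrite yx eqSS; case: ltngtP xj => //; lia.
case: (ltnP j n) => [jn|nj]; last first.
  have full t : cnt t j.+1 = cnt t j.
    by apply: eq_bigl => i; rewrite ltnS ltnW ?(leq_trans (ltn_ord i)).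
  rewrite !full IHj; case: eqP => // jy'; move: (ltn_ord y); lia.
rewrite !(cntS _ (Ordinal jn)) /= IHj; case: (eqVneq j y) => [jy'|jy'].
  have -> : Ordinal jn = y by apply: val_inj.
  rewrite jy' (cnt_edge s yx) put_r // -!addnA ab //.
by rewrite put_ne // -val_eqE /=; apply/eqP; lia.
Qed.

Lemma cnt_put_full x y a b s : y = x.+1 :> nat -> (a + b = s x + s y)%N ->
  cnt (put x y a b s) n = cnt s n.
Proof. by move=> yx ab; rewrite cnt_put // gtn_eqF. Qed.

Lemma sum_edges (R : zmodType) (F : nat -> R) :
  \sum_(e : 'I_n * 'I_n | (e.2 : nat) == e.1.+1) F e.2 = \sum_(1 <= j < n) F j.
Proof.
rewrite -(pair_big_dep xpredT (fun x y : 'I_n => (y : nat) == x.+1) (fun _ y => F y)) /=.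
rewrite (exchange_big_dep xpredT) //=; case: n => [|m].
  by rewrite big_ord0 big_geq.
rewrite big_ord_recl big_pred0 // add0r big_add1 big_mkord; apply: eq_bigr => i _.
by rewrite (big_pred1 (widen_ord (leqnSn m) i)) //= => x; rewrite eqSS eq_sym.
Qed.

End Counting.

(** * The one-step operator on functions of 0/1 sequences *)

Section Generator.
Variables (R : realType) (n : nat) (beta : R).
Implicit Types (F : {ffun 'I_n -> bool} -> R) (s : {ffun 'I_n -> bool}) (x y : 'I_n).

Definition edge_avg x y F s : R :=
  if s x == s y then F s
  else (1 + beta) / 2 * F (put x y false true s)
     + (1 - beta) / 2 * F (put x y true false s).

(** Acts on functions of all 0/1 sequences, so that [put] needs no proof of conserving [k];
    [evolve_exclusion] restricts it to configurations. *)
Definition gen F s : R :=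
  (n.-1%:R)^-1 * \sum_(e : 'I_n * 'I_n | (e.2 : nat) == e.1.+1) edge_avg e.1 e.2 F s.

Lemma sum_config k (z : {ffun 'I_n -> bool}) F : (\sum_(i < n) z i)%N == k ->
  \sum_(c : config n k) (val c == z)%:R * F (val c) = F z.
Proof.
move=> zk; rewrite (bigD1 (exist _ z zk)) //= eqxx mul1r big1 ?addr0 // => c.
by rewrite -val_eqE /= => /negbTE ->; rewrite mul0r.
Qed.

Lemma sum_edge_update k (c : config n k) x y F : y = x.+1 :> nat ->
  \sum_(c' : config n k) edge_update beta x y (val c) (val c') * F (val c')
  = edge_avg x y F (val c).
Proof.
move=> yx; rewrite /edge_update /edge_avg.
have [_|neq] := eqVneq (val c x) (val c y); first by rewrite sum_config // (valP c).
have put_k a : (\sum_(i < n) put x y a (~~ a) (val c) i)%N == k.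
  rewrite -cnt_full cnt_put_full // ?cnt_full ?(valP c) //.
  by case: (val c x) (val c y) a neq => [] [] [].
under eq_bigr do rewrite mulrDl -!mulrA.
by rewrite big_split -!mulr_sumr /= !sum_config ?mulrA.
Qed.

Lemma evolve_exclusion k F (c : config n k) :
  evolve (exclusion n k beta) (fun c => F (val c)) c = gen F (val c).
Proof.
rewrite /evolve /exclusion /gen.
under eq_bigr do rewrite -mulrA mulr_suml.
rewrite -mulr_sumr exchange_big /=; congr (_ * _); apply: eq_bigr => e /eqP e12.
by rewrite sum_edge_update.
Qed.

Lemma iter_evolve_exclusion k F t (c : config n k) :
  iter t (evolve (exclusion n k beta)) (fun c => F (val c)) c = iter t gen F (val c).
Proof.
have -> : iter t (evolve (exclusion n k beta)) (fun c => F (val c))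
          = fun c => iter t gen F (val c).
  elim: t => //= t ->; apply/funext => d; exact: evolve_exclusion.
by [].
Qed.

Lemma exclusion_ge0 k (c c' : config n k) : 0 < beta < 1 -> 0 <= exclusion n k beta c c'.
Proof.
move=> /andP[b0 b1]; rewrite mulr_ge0 ?invr_ge0 //; apply: sumr_ge0 => e _.
by rewrite /edge_update; case: ifP => // _; rewrite addr_ge0 // mulr_ge0 //; lra.
Qed.

Hypothesis n_gt1 : (1 < n)%N.

Lemma predn_gt0 : 0 < n.-1%:R :> R.
Proof. by rewrite ltr0n -ltnS prednK // ltnW. Qed.

Lemma sum_edges_cst (a : R) :
  \sum_(e : 'I_n * 'I_n | (e.2 : nat) == e.1.+1) a = n.-1%:R * a.
Proof. by rewrite (sum_edges n (fun=> a)) sumr_const_nat subn1 mulr_natl. Qed.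

Lemma gen_sub F s : gen F s - F s =
  (n.-1%:R)^-1 * \sum_(e : 'I_n * 'I_n | (e.2 : nat) == e.1.+1)
     (edge_avg e.1 e.2 F s - F s).
Proof.
by rewrite sumrB sum_edges_cst mulrBr mulKf // gt_eqF // predn_gt0.
Qed.

Lemma exclusion_sum1 k (c : config n k) : \sum_c' exclusion n k beta c c' = 1.
Proof.
have := evolve_exclusion (fun=> 1) c; rewrite /evolve; under eq_bigr do rewrite mulr1.
move=> ->; rewrite /gen (eq_bigr (fun=> 1)) => [|e _].
  by rewrite sum_edges_cst mulr1 mulVf // gt_eqF // predn_gt0.
by rewrite /edge_avg; case: ifP => // _; rewrite !mulr1; field.
Qed.

End Generator.

(** * Effect of one edge update on weighted Lipschitz functions *)

Section Contraction.
Variables (R : realType) (n : nat) (beta : R).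
Hypotheses (n_gt1 : (1 < n)%N) (beta01 : 0 < beta < 1).
Implicit Types (F : {ffun 'I_n -> bool} -> R) (s : {ffun 'I_n -> bool}) (x y u v : 'I_n).

(* Chosen so that [(1 + beta) * alpha] and [(1 - beta) / alpha] are both at most
   [kappa = 1 - beta ^ 2 / 2]. *)
Definition alpha : R := (2 - beta ^+ 2) / (2 * (1 + beta)).

Definition kappa : R := 1 - beta ^+ 2 / 2.

Definition parab (j : nat) : R := j%:R * (n%:R - j%:R).

(** This is [alpha] to the height [j - 2 * cnt s j]; the exponent may be negative, hence two natural
    powers. *)
Definition height_weight s (j : nat) : R := alpha ^+ j * alpha^-1 ^+ (2 * cnt s j).

(** Since [put] overwrites both endpoints and the weight is read at [x], where only sites left of
    the edge count, [s] is merely the common background of the two sequences. *)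
Definition lipschitz F (L : R) : Prop := forall s x y, y = x.+1 :> nat ->
  `|F (put x y true false s) - F (put x y false true s)|
     <= L * (parab y * height_weight s x).

Lemma alpha_gt0 : 0 < alpha.
Proof. by case/andP: beta01 => b0 b1; rewrite divr_gt0 //; nra. Qed.

Lemma alpha_le1 : alpha <= 1.
Proof. by case/andP: beta01 => b0 b1; rewrite ler_pdivrMr; nra. Qed.

Lemma kappa_right : (1 + beta) / 2 * alpha = kappa / 2.
Proof.
case/andP: beta01 => b0 b1; rewrite /alpha /kappa; field.
by rewrite gt_eqF //; lra.
Qed.

Lemma kappa_left : (1 - beta) / 2 / alpha <= kappa / 2.
Proof.
case/andP: beta01 => b0 b1; rewrite ler_pdivrMr ?alpha_gt0 // /alpha /kappa.
rewrite mulrA ler_pdivlMr; last by lra.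
have : 0 <= beta ^+ 2 ^+ 2 by exact: sqr_ge0.
by nra.
Qed.

Lemma parab_ge0 (j : nat) : (j <= n)%N -> 0 <= parab j.
Proof. by move=> jn; rewrite mulr_ge0 // subr_ge0 ler_nat. Qed.

Lemma height_weight_gt0 s j : 0 < height_weight s j.
Proof. by rewrite mulr_gt0 // exprn_gt0 ?invr_gt0 ?alpha_gt0. Qed.

Lemma height_weight_edge s x y : y = x.+1 :> nat ->
  height_weight s y = height_weight s x * (if s x then alpha^-1 else alpha).
Proof.
move=> yx; have a0 : alpha != 0 by rewrite gt_eqF ?alpha_gt0.
rewrite /height_weight (cnt_edge s yx) yx exprS mulnDr exprD.
by case: (s x) => /=; rewrite ?muln1 ?muln0 ?expr0 ?expr2; field.
Qed.

Lemma height_weight_put x y a b s j : y = x.+1 :> nat -> (j <= x)%N ->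
  height_weight (put x y a b s) j = height_weight s j.
Proof. by move=> yx jx; rewrite /height_weight cnt_put_low. Qed.

Lemma ler_norm_shift (a b c A B : R) : 0 <= c -> `|a| <= A -> `|b| <= B ->
  `|a + c * b| <= A + c * B.
Proof.
move=> c0 aA bB; apply: le_trans (ler_normD _ _) _.
by rewrite normrM (ger0_norm c0) lerD // ler_wpM2l.
Qed.

(** Updating the edge itself merges the two sequences, and a disjoint edge leaves them one move
    apart. At an adjacent edge one sequence is frozen and the other may move, which adds a
    discrepancy there. A right move always meets a weight multiplied by [alpha] and a left move a
    weight divided by [alpha], hence the common bound [kappa / 2]. *)
Lemma edge_contraction F (L : R) s x y u v : lipschitz F L -> 0 <= L ->
  y = x.+1 :> nat -> v = u.+1 :> nat ->
  `|edge_avg beta u v F (put x y true false s) - edge_avg beta u v F (put x y false true s)|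
  <= L * height_weight s x *
     ((v != y)%:R * parab y + kappa / 2 * parab v * ((v.+1 == y)%:R + (v == y.+1 :> nat)%:R)).
Proof.
move=> lipF L0 yx vu; case/andP: beta01 => b0 b1.
have p0 : 0 <= (1 + beta) / 2 by lra.
have q0 : 0 <= (1 - beta) / 2 by lra.
have yNx := edge_neq yx; have vNu := edge_neq vu.
have hw0 := height_weight_gt0 s x.
have alphaN0 : alpha != 0 by rewrite gt_eqF ?alpha_gt0.
have wv0 : 0 <= parab v by rewrite parab_ge0 // ltnW.
have lip_s := lipF s x y yx.
have kr (h : R) : 0 < h -> (1 + beta) / 2 * (L * (parab v * (h * alpha))) = kappa / 2 * (L * (parab v * h)).
  by move=> _; rewrite -kappa_right; ring.
have kl (h : R) : 0 < h ->
    (1 - beta) / 2 * (L * (parab v * (h / alpha))) <= kappa / 2 * (L * (parab v * h)).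
  move=> h0; have -> : (1 - beta) / 2 * (L * (parab v * (h / alpha))) =
    (1 - beta) / 2 / alpha * (L * (parab v * h)) by ring.
  by rewrite ler_wpM2r ?kappa_left // mulr_ge0 // mulr_ge0 // ltW.
have [vy|vNy] := eqVneq v y.
  have ux : u = x by apply: val_inj; move: vu yx; rewrite vy => -> [].
  subst u v; rewrite /edge_avg !put_l !put_r //= !put_put subrr normr0.
  by rewrite gtn_eqF ?ltnSn // ltn_eqF // mul0r addr0 mulr0 addr0 mulr0.
have uNx : u != x.
  by apply: contraNneq vNy => ux; apply/eqP/val_inj; rewrite /= vu yx ux.
rewrite mul1r; have [vx|vNx] := eqVneq v x.
  subst v; have uNy : u != y by rewrite -val_eqE neq_ltn /= yx vu ltnS leqnSn.
  have -> : ((x : nat) == y.+1) = false by rewrite yx ltn_eqF // ltnS leqnSn.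
  rewrite -yx eqxx addr0 mulr1.
  have au a b : put x y a b s u = s u by rewrite put_ne.
  have hwput a b : height_weight (put x y a b s) u = height_weight s u.
    by rewrite height_weight_put // vu.
  have id_put a b : put u x (s u) a (put x y a b s) = put x y a b s.
    by have := put_id u x (put x y a b s); rewrite au put_l.
  rewrite /edge_avg !au !put_l; have := height_weight_edge s vu.
  case su: (s u) id_put => /= id_put hwx.
    have hwu : height_weight s u = height_weight s x * alpha by rewrite hwx divfK.
    have := lipF (put x y false true s) u x vu; rewrite id_put hwput hwu.
    set A := F (put x y true false s); set B := F (put x y false true s).
    set C := F (put u x false true _) => lip_u.
    have -> : A - ((1 + beta) / 2 * C + (1 - beta) / 2 * B) =
              (A - B) + (1 + beta) / 2 * (B - C) by field.
    apply: le_trans (ler_norm_shift p0 lip_s lip_u) _.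
    by rewrite kr // le_eqVlt; apply/orP; left; apply/eqP; ring.
  have hwu : height_weight s u = height_weight s x / alpha by rewrite hwx mulfK.
  have := lipF (put x y true false s) u x vu; rewrite id_put hwput hwu.
  set A := F (put x y true false s); set B := F (put x y false true s).
  set C := F (put u x true false _) => lip_u.
  have -> : (1 + beta) / 2 * A + (1 - beta) / 2 * C - B =
            (A - B) + (1 - beta) / 2 * (C - A) by field.
  apply: le_trans (ler_norm_shift q0 lip_s lip_u) _.
  by apply: le_trans (lerD (lexx _) (kl _ hw0)) _; rewrite le_eqVlt; apply/orP; left; apply/eqP; ring.
have -> : (v.+1 == y) = false.
  by apply/eqP => vy1; move/eqP: vNx; apply; apply: val_inj; move: vy1; rewrite yx => -[].
rewrite add0r; have [uy|uNy] := eqVneq u y.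
  subst u; rewrite vu eqxx mulr1.
  have av a b : put x y a b s v = s v by rewrite put_ne.
  have id_put a b : put y v b (s v) (put x y a b s) = put x y a b s.
    by have := put_id y v (put x y a b s); rewrite av put_r.
  have hwy a b : height_weight (put x y a b s) y =
      height_weight s x * (if a then alpha^-1 else alpha).
    by rewrite (height_weight_edge _ yx) put_l height_weight_put.
  rewrite /edge_avg !av !put_r //; case sv: (s v) id_put => /= id_put.
    have := lipF (put x y true false s) y v vu; rewrite id_put hwy.
    set A := F (put x y true false s); set B := F (put x y false true s).
    set C := F (put y v true false _) => lip_u.
    have -> : (1 + beta) / 2 * A + (1 - beta) / 2 * C - B =
              (A - B) + (1 - beta) / 2 * (C - A) by field.
    apply: le_trans (ler_norm_shift q0 lip_s lip_u) _.
    apply: le_trans (lerD (lexx _) (kl _ hw0)) _.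
    by rewrite -vu le_eqVlt; apply/orP; left; apply/eqP; ring.
  have := lipF (put x y false true s) y v vu; rewrite id_put hwy.
  set A := F (put x y true false s); set B := F (put x y false true s).
  set C := F (put y v false true _) => lip_u.
  have -> : A - ((1 + beta) / 2 * C + (1 - beta) / 2 * B) =
            (A - B) + (1 + beta) / 2 * (B - C) by field.
  apply: le_trans (ler_norm_shift p0 lip_s lip_u) _.
  by rewrite kr // -vu le_eqVlt; apply/orP; left; apply/eqP; ring.
have -> : ((v : nat) == y.+1) = false.
  by apply/eqP => vy1; move/eqP: uNy; apply; apply: val_inj; move: vy1; rewrite vu => -[].
rewrite mulr0 addr0 /edge_avg !(put_ne _ _ _ uNx uNy) !(put_ne _ _ _ vNx vNy).
have [suv|suv] := eqVneq (s u) (s v).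
  by apply: le_trans lip_s _; rewrite le_eqVlt; apply/orP; left; apply/eqP; ring.
have hw a : height_weight (put u v a (~~ a) s) x = height_weight s x.
  rewrite /height_weight cnt_put //; first by rewrite eq_sym val_eqE (negbTE vNx).
  by case: (s u) (s v) a suv => [] [] [].
have := lipF (put u v false true s) x y yx; have := lipF (put u v true false s) x y yx.
rewrite (hw true) (hw false) => lipT lipF'.
rewrite !(putC _ _ _ _ _ uNx uNy vNx vNy).
move: lipT lipF'; set A := F _; set B := F _; set C := F _; set D := F _ => lipT lipF'.
have -> : (1 + beta) / 2 * C + (1 - beta) / 2 * A - ((1 + beta) / 2 * D + (1 - beta) / 2 * B) =
   (1 + beta) / 2 * (C - D) + (1 - beta) / 2 * (A - B) by ring.
apply: le_trans (ler_norm_shift q0 (_ : _ <= (1 + beta) / 2 * (L * (parab y * height_weight s x))) lipT) _.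
  by rewrite normrM (ger0_norm p0) ler_wpM2l.
by rewrite le_eqVlt; apply/orP; left; apply/eqP; field.
Qed.

End Contraction.

(** * Potential and paths between configurations *)

Section Potential.
Variable n : nat.
Implicit Types (s : {ffun 'I_n -> bool}) (x y : 'I_n).

(** A particle at site [i] contributes [n - 1 - i], so this is the total distance to the right end.
    In this form a move changes only one term. *)
Definition potential s : nat := (\sum_(1 <= j < n) cnt s j)%N.

Lemma potential_put x y (a b : bool) s : y = x.+1 :> nat -> (a + b = s x + s y)%N ->
  (potential (put x y a b s) + s x = potential s + a)%N.
Proof.
move=> yx ab; rewrite /potential.
have yI : (y : nat) \in index_iota 1 n by rewrite mem_index_iota yx ltnS leq0n -yx ltn_ord.
rewrite !(bigD1_seq (y : nat) yI (iota_uniq _ _)) /= cnt_put // eqxx (cnt_edge s yx).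
rewrite [in LHS](eq_bigr (cnt s)) => [|j /negbTE jy]; last by rewrite cnt_put // jy.
lia.
Qed.

Lemma potential_le s : (potential s <= n * n)%N.
Proof.
rewrite /potential; apply: (@leq_trans (\sum_(1 <= j < n) n)); last first.
  by rewrite sum_nat_const_nat leq_mul2r leq_subr orbT.
rewrite big_nat_cond [leqRHS]big_nat_cond; apply: leq_sum => j /andP[/andP[_ jn] _].
exact: leq_trans (cnt_leq s j) (ltnW jn).
Qed.

(** Such sequences are monotone, so their sets of particles are nested; equal cardinalities then
    force equality. *)
Lemma no_descent_uniq s s' :
  (forall x y, y = x.+1 :> nat -> s x -> s y) ->
  (forall x y, y = x.+1 :> nat -> s' x -> s' y) -> cnt s n = cnt s' n -> s = s'.
Proof.
move=> sP s'P.
have mono (t : {ffun 'I_n -> bool}) : (forall x y, y = x.+1 :> nat -> t x -> t y) ->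
    forall x y, (x <= y)%N -> t x -> t y.
  move=> tP x y xy tx; have : (y = x + (y - x) :> nat)%N by rewrite subnKC.
  move: (y - x)%N => d; elim: d y {xy} => [|d IHd] y yd.
    by have -> : y = x by apply: val_inj; rewrite /= yd addn0.
  have zn : (x + d < n)%N by rewrite (leq_trans _ (ltn_ord y)) // yd addnS ltnS.
  by apply: (tP (Ordinal zn)); [rewrite yd addnS | apply: IHd].
wlog [x /andP[sx s'x]] : s s' sP s'P / exists x, s x && ~~ s' x => [wl ss'|ss'].
  apply/ffunP => z; case sz: (s z); case s'z: (s' z) => //.
    have e : exists x, s x && ~~ s' x by exists z; rewrite sz s'z.
    by rewrite -sz -s'z (wl s s' sP s'P e ss').
  have e : exists x, s' x && ~~ s x by exists z; rewrite sz s'z.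
  by rewrite -sz -s'z (wl s' s s'P sP e (esym ss')).
exfalso; move: ss'; apply/eqP; rewrite eq_sym neq_ltn; apply/orP; left.
rewrite !cnt_full (bigD1 x) //= [ltnRHS](bigD1 x) //= sx (negbTE s'x) add0n add1n ltnS.
apply: leq_sum => z _; case s'z: (s' z) => //; rewrite (mono s sP x z) //.
by rewrite leqNgt; apply: contra s'x => zx; apply: (mono s' s'P z x) => //; apply: ltnW.
Qed.

(** Both sequences are pushed to the right-packed one. Each right move lowers [potential] by one, so
    at most [n ^ 2] moves are needed on either side. *)
Lemma potential_path (R : realType) (F : {ffun 'I_n -> bool} -> R) (B : R) s s' :
  0 <= B ->
  (forall s x y, y = x.+1 :> nat -> s x -> ~~ s y -> `|F s - F (put x y false true s)| <= B) ->
  cnt s n = cnt s' n -> `|F s - F s'| <= 2 * n%:R ^+ 2 * B.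
Proof.
move=> B0 FB ss'.
have descend m t : (potential t <= m)%N -> exists r : {ffun 'I_n -> bool},
    [/\ forall x y, y = x.+1 :> nat -> r x -> r y, cnt r n = cnt t n
      & `|F t - F r| <= m%:R * B].
  elim: m t => [|m IHm] t tm.
    exists t; split=> // [x y yx tx|]; last by rewrite subrr normr0 mul0r.
    apply/negPn/negP => ty; have := @potential_put x y false true t yx.
    by rewrite tx (negbTE ty) => /(_ erefl); lia.
  have [/existsP[x /existsP[y /and3P[/eqP yx tx ty]]]|] :=
    boolP [exists x : 'I_n, [exists y : 'I_n, [&& (y : nat) == x.+1, t x & ~~ t y]]].
    have nb : (false + true = t x + t y)%N by rewrite tx (negbTE ty).
    have := potential_put yx nb; rewrite tx => pot.
    have /IHm[r [rP rn rB]] : (potential (put x y false true t) <= m)%N by lia.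
    exists r; split=> //; first by rewrite rn cnt_put_full.
    rewrite -natr1 mulrDl mul1r [_ + B]addrC -(subrKA (F (put x y false true t))).
    by apply: le_trans (ler_normD _ _) _; rewrite lerD // FB.
  move=> /existsPn none; exists t; split=> // [x y yx tx|]; last first.
    by rewrite subrr normr0 mulr_ge0.
  have /existsPn/(_ y) := none x; rewrite yx eqxx tx /=; by case: (t y).
have [r [rP rn rB]] := descend _ s (potential_le s).
have [r' [r'P r'n r'B]] := descend _ s' (potential_le s').
have rr' : r = r' by apply: no_descent_uniq; rewrite // rn ss' r'n.
rewrite -(subrKA (F r)); apply: le_trans (ler_normD _ _) _.
have -> : 2 * n%:R ^+ 2 * B = (n * n)%:R * B + (n * n)%:R * B by rewrite natrM; ring.
by rewrite lerD // {1}rr' distrC.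
Qed.

End Potential.

(** * Contraction of the full step and decay of oscillations *)

Section UpperBound.
Variables (R : realType) (n : nat) (beta : R).
Hypotheses (n_gt1 : (1 < n)%N) (beta01 : 0 < beta < 1).
Implicit Types (F : {ffun 'I_n -> bool} -> R) (s : {ffun 'I_n -> bool}) (x y : 'I_n).

Definition delta : R := beta ^+ 2 / 2 + n%:R ^- 2.

Lemma sum_delta (g : nat -> R) (m : nat) :
  \sum_(1 <= j < n) g j * (j == m)%:R = (if (1 <= m < n)%N then g m else 0).
Proof.
case: ifP => mn.
  have mI : m \in index_iota 1 n by rewrite mem_index_iota.
  rewrite (bigD1_seq m mI (iota_uniq _ _)) /= eqxx mulr1 big1 ?addr0 // => j /negbTE ->.
  by rewrite mulr0.
rewrite big_nat_cond big1 // => j /andP[jn _]; case: eqP jn => [->|]; last by rewrite mulr0.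
by rewrite mn.
Qed.

Let n_gt0 : 0 < n%:R :> R. Proof. by rewrite ltr0n ltnW. Qed.

Let n_ge2 : 2 <= n%:R :> R. Proof. by rewrite ler_nat. Qed.

Let pn : n.-1%:R = n%:R - 1 :> R.
Proof. by rewrite -subn1 natrB // ltnW. Qed.

Lemma rate_ge0 : 0 <= 1 - delta / n.-1%:R.
Proof.
case/andP: beta01 => b0 b1; rewrite subr_ge0 ler_pdivrMr ?predn_gt0 // mul1r pn /delta.
have n2 := n_ge2; have : n%:R ^- 2 <= 1 / 4 :> R.
  by rewrite -div1r ler_pdivrMr ?exprn_gt0 //; nra.
by move=> h; nra.
Qed.

Lemma lipschitz_gen F (L : R) : lipschitz beta F L -> 0 <= L ->
  lipschitz beta (gen beta F) (L * (1 - delta / n.-1%:R)).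
Proof.
move=> lipF L0 s x y yx; have [b0 b1] := andP beta01.
have hw0 := height_weight_gt0 beta01 s x.
have y0 : (0 < y)%N by rewrite yx.
have yn : (y < n)%N by [].
pose B (j : nat) : R := (j != y)%:R * parab R n y
   + kappa beta / 2 * parab R n j * ((j.+1 == y)%:R + (j == y.+1)%:R).
rewrite /gen -mulrBr -sumrB normrM ger0_norm ?invr_ge0 //.
apply: (@le_trans _ _ ((n.-1%:R)^-1 * (L * height_weight beta s x * \sum_(1 <= j < n) B j))).
  rewrite ler_wpM2l ?invr_ge0 // -sum_edges mulr_sumr.
  apply: le_trans (ler_norm_sum _ _ _) _; apply: ler_sum => e /eqP e12.
  exact: edge_contraction.
(* The parabola vanishes at [0] and [n], so both neighbouring values may be written even when the
   neighbouring edge does not exist. *)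
have -> : \sum_(1 <= j < n) B j = (n%:R - 2) * parab R n y
   + kappa beta / 2 * (parab R n y.-1 + parab R n y.+1).
  rewrite /B big_split /=; congr (_ + _).
    have neqE (j : nat) : (j != y)%:R = 1 - 1 * (j == y)%:R :> R.
      by case: (j == y); rewrite mul1r ?subrr ?subr0.
    under eq_bigr => j _ do rewrite neqE.
    rewrite -mulr_suml sumrB sum_delta y0 yn /= sumr_const_nat.
    by rewrite -[_ *+ _]/((n - 1)%:R) subn1 pn; congr (_ * _); ring.
  under eq_bigr => j _ do rewrite mulrDr.
  rewrite big_split /= mulrDr; congr (_ + _).
    under eq_bigr => j _ do rewrite -{1}(prednK y0) eqSS.
    rewrite sum_delta; case: ifP => // /negbT.
    have -> : (y.-1 < n)%N by rewrite (leq_ltn_trans (leq_pred _)).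
    by rewrite andbT -eqn0Ngt => /eqP ->; rewrite /parab mul0r mulr0.
  rewrite sum_delta; case: ifP => // /negbT; rewrite ltnS leq0n /= -leqNgt => ny.
  have -> : y.+1 = n by apply/eqP; rewrite eqn_leq yn ny.
  by rewrite /parab subrr !mulr0.
have py : y.-1%:R = y%:R - 1 :> R by rewrite -subn1 natrB.
have -> : parab R n y.-1 + parab R n y.+1 = 2 * parab R n y - 2.
  by rewrite /parab py -natr1; ring.
set w := parab R n y; set h := height_weight _ _ _ in hw0 *.
have w_le : w <= n%:R ^+ 2 / 4.
  by rewrite /w /parab ler_pdivlMr //; have := sqr_ge0 (n%:R - 2 * y%:R : R); nra.
have w0 : 0 <= w by rewrite parab_ge0 // ltnW.
(* The gain [kappa] comes from the second difference of the parabola; it covers [w / n ^ 2 <= 1 / 4]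
   because [kappa >= 1 / 2]. *)
have dw : delta * w <= beta ^+ 2 / 2 * w + kappa beta.
  rewrite /delta mulrDl lerD2l mulrC ler_pdivrMr ?exprn_gt0 //.
  rewrite /kappa; have : 1 / 2 <= 1 - beta ^+ 2 / 2 by nra.
  have : 0 < n%:R ^+ 2 :> R by rewrite exprn_gt0.
  by nra.
have -> : L * (1 - delta / n.-1%:R) * (w * h) =
  (n.-1%:R)^-1 * (L * h * (n.-1%:R * w - delta * w)).
  by field; rewrite gt_eqF // predn_gt0.
have Lh0 : 0 <= L * h by rewrite mulr_ge0 // ltW.
rewrite ler_wpM2l ?invr_ge0 // (ler_wpM2l Lh0) // pn.
by move: dw; rewrite /kappa; lra.
Qed.

Lemma lipschitz_iter F (L : R) t : lipschitz beta F L -> 0 <= L ->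
  lipschitz beta (iter t (gen beta) F) (L * (1 - delta / n.-1%:R) ^+ t).
Proof.
move=> lipF L0; elim: t => [|t IHt]; first by rewrite mulr1.
rewrite exprSr mulrA; apply: lipschitz_gen => //.
by rewrite mulr_ge0 // exprn_ge0 // rate_ge0.
Qed.

Lemma lipschitz_bounded F : (forall s, 0 <= F s <= 1) ->
  lipschitz beta F ((alpha beta)^-1 ^+ n).
Proof.
move=> F01 s x y yx; apply: (@le_trans _ _ 1).
  have /andP[] := F01 (put x y true false s); have /andP[] := F01 (put x y false true s).
  by move=> ? ? ? ?; rewrite ler_norml; apply/andP; split; lra.
have a0 := alpha_gt0 beta01; have a1 := alpha_le1 beta01.
rewrite exprVn ler_pdivlMl ?exprn_gt0 // mulr1 -[leLHS]mul1r.
apply: ler_pM => //; first by rewrite exprn_ge0 // ltW.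
  rewrite /parab -natrB ?(ltnW (ltn_ord y)) // -natrM ler1n muln_gt0 yx /=.
  by rewrite -yx subn_gt0.
rewrite /height_weight -[leLHS]mulr1; apply: ler_pM => //; first by rewrite exprn_ge0 // ltW.
  by apply: ler_wiXn2l => //; [exact: ltW | exact: ltnW].
by rewrite exprn_ege1 // invf_ge1.
Qed.

Lemma height_weight_le s x : height_weight beta s x <= (alpha beta)^-1 ^+ n.
Proof.
have a0 := alpha_gt0 beta01; have a1 := alpha_le1 beta01.
have ai : 1 <= (alpha beta)^-1 by rewrite invf_ge1.
apply: (@le_trans _ _ ((alpha beta)^-1 ^+ x)); last by rewrite ler_weXn2l // ltnW.
apply: (@le_trans _ _ (alpha beta ^+ x * (alpha beta)^-1 ^+ (2 * x))).
  have ax0 : 0 <= alpha beta ^+ x by rewrite exprn_ge0 // ltW.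
  by rewrite /height_weight (ler_wpM2l ax0) // ler_weXn2l // leq_mul2l cnt_leq.
rewrite mul2n -addnn exprD mulrA -exprMn divff ?expr1n ?mul1r //.
by rewrite gt_eqF.
Qed.

Lemma iter_gen_osc F t s s' : (forall s, 0 <= F s <= 1) -> cnt s n = cnt s' n ->
  `|iter t (gen beta) F s - iter t (gen beta) F s'| <=
    2 * n%:R ^+ 4 * (alpha beta)^-1 ^+ (2 * n) * (1 - delta / n.-1%:R) ^+ t.
Proof.
move=> F01 ss'; have a0 := alpha_gt0 beta01; have r0 := rate_ge0.
have -> : 2 * n%:R ^+ 4 * (alpha beta)^-1 ^+ (2 * n) * (1 - delta / n.-1%:R) ^+ t =
  2 * n%:R ^+ 2 * ((alpha beta)^-1 ^+ n * (1 - delta / n.-1%:R) ^+ t *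
    (n%:R ^+ 2 * (alpha beta)^-1 ^+ n)).
  by rewrite mul2n -addnn exprD; ring.
have an0 : 0 <= (alpha beta)^-1 ^+ n by rewrite exprn_ge0 // invr_ge0 ltW.
apply: potential_path => // [|r x y yx rx ry].
  by rewrite !mulr_ge0 // exprn_ge0.
have := lipschitz_iter t (lipschitz_bounded F01) an0 => /(_ r x y yx).
have {1}-> : put x y true false r = r by rewrite -[RHS](put_id x y) rx (negbTE ry).
have Lr0 : 0 <= (alpha beta)^-1 ^+ n * (1 - delta / n.-1%:R) ^+ t.
  by rewrite mulr_ge0 // exprn_ge0.
move=> /le_trans; apply; rewrite (ler_wpM2l Lr0) //.
apply: ler_pM; rewrite ?height_weight_le ?parab_ge0 ?(ltnW (ltn_ord y)) //.
  by rewrite ltW // height_weight_gt0.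
rewrite /parab expr2; apply: ler_pM; rewrite ?subr_ge0 ?ler_nat // ?(ltnW (ltn_ord y)) //.
by rewrite gerBl.
Qed.

End UpperBound.

(** * Reversibility, the Gibbs measure and the upper bound on the distance *)

Lemma reversible_stationary (R : realType) (T : finType) (P : T -> T -> R) (W : T -> R) :
  (forall x, \sum_y P x y = 1) -> (forall x, 0 <= W x) -> 0 < \sum_x W x ->
  (forall x y, W x * P x y = W y * P y x) ->
  is_stationary P (fun x => W x / \sum_x W x).
Proof.
move=> P1 W0 sW rev; split=> [x||].
- by rewrite divr_ge0 // ltW.
- by rewrite -mulr_suml divff // gt_eqF.
- apply/funext => y; rewrite /step -[RHS]mulr1 -(P1 y) mulr_sumr.
  by apply: eq_bigr => x _; rewrite mulrAC rev mulrAC.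
Qed.

Section Stationary.
Variables (R : realType) (n k : nat) (beta : R).
Hypotheses (n_gt1 : (1 < n)%N) (beta01 : 0 < beta < 1) (k_le : (k <= n)%N).
Implicit Types (s : {ffun 'I_n -> bool}) (x y : 'I_n).

Definition left_packed : {ffun 'I_n -> bool} := [ffun i : 'I_n => (i < k)%N].

Lemma cnt_left_packed j : (j <= n)%N -> cnt left_packed j = minn j k.
Proof.
elim: j => [|j IHj] jn; first by rewrite cnt0 min0n.
have := cntS left_packed (Ordinal jn); rewrite [left_packed _]ffunE /= => ->.
rewrite IHj; last exact: ltnW.
rewrite /minn; case: (ltnP j k) => jk; case: (ltnP j.+1 k) => jk'; rewrite ?addn1 ?addn0 //.
- by apply/eqP; rewrite eqn_leq jk jk'.
- by move: jk'; rewrite ltnNge (leq_trans jk (leqnSn j)).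
Qed.

Lemma left_packed_subproof : (\sum_(i < n) left_packed i)%N == k.
Proof. by rewrite -cnt_full cnt_left_packed // (minn_idPr k_le). Qed.

Definition left_config : config n k := exist _ left_packed left_packed_subproof.

Definition ratio : R := (1 - beta) / (1 + beta).

Lemma ratio_gt0 : 0 < ratio.
Proof. by case/andP: beta01 => b0 b1; rewrite divr_gt0 //; lra. Qed.

(** The essential case of detailed balance: moving the particle from [y] to [x] raises [potential]
    by one, and [ratio] is the left rate over the right rate. If [s] and [s'] are not related by
    this move, both sides vanish. *)
Lemma edge_update_rev_half s s' x y : y = x.+1 :> nat ->
  ~~ s x -> s y -> s' x -> ~~ s' y ->
  ratio ^+ potential s * edge_update beta x y s s' =
  ratio ^+ potential s' * edge_update beta x y s' s.
Proof.
move=> yx sx sy s'x s'y; have yNx := edge_neq yx; case/andP: beta01 => b0 b1.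
rewrite /edge_update (negbTE sx) sy s'x (negbTE s'y) /=.
have -> : (s' == put x y false true s) = false.
  by apply/eqP => /ffunP/(_ x); rewrite put_l s'x.
have -> : (s == put x y true false s') = false.
  by apply/eqP => /ffunP/(_ x); rewrite put_l (negbTE sx).
rewrite !mulr0 add0r addr0.
have sE : put x y false true s = s by rewrite -[RHS](put_id x y) (negbTE sx) sy.
have s'E : put x y true false s' = s' by rewrite -[RHS](put_id x y) s'x (negbTE s'y).
have [s'B|/eqP s'NB] := eqVneq s' (put x y true false s).
  have -> : (s == put x y false true s') = true by rewrite s'B put_put sE eqxx.
  have nb : (true + false = s x + s y)%N by rewrite (negbTE sx) sy.
  have := potential_put yx nb; rewrite -s'B (negbTE sx) addn0 addn1 => ->.
  by rewrite exprS /ratio; field; rewrite gt_eqF //; lra.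
have -> : (s == put x y false true s') = false.
  by apply/eqP => sA; apply: s'NB; rewrite sA put_put s'E.
by rewrite !mulr0.
Qed.

Lemma edge_update_rev s s' x y : y = x.+1 :> nat ->
  ratio ^+ potential s * edge_update beta x y s s' =
  ratio ^+ potential s' * edge_update beta x y s' s.
Proof.
move=> yx; have yNx := edge_neq yx.
have diag (t t' : {ffun 'I_n -> bool}) a : t x == t y -> t' x != t' y -> t == put x y a (~~ a) t' = false.
  move=> tt t't'; apply/eqP => tP; move: tt; rewrite tP put_l put_r //.
  by case: a {tP}.
have [->//|ss'] := eqVneq s s'.
(* Such sequences also agree at [y], hence differ off the edge, where an update of the edge changes
   nothing. *)
have same (t t' : {ffun 'I_n -> bool}) : t != t' -> t x != t y -> t' x != t' y -> t x = t' x ->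
    edge_update beta x y t t' = 0.
  move=> tt' tt t't' txt'x; rewrite /edge_update (negbTE tt).
  have -> : (t' == put x y false true t) = false.
    apply/eqP => t'P; move/eqP: tt'; apply; rewrite -[LHS](put_id x y).
    by move: txt'x tt; rewrite t'P put_l => ->; case: (t y) => // _; rewrite t'P.
  have -> : (t' == put x y true false t) = false.
    apply/eqP => t'P; move/eqP: tt'; apply; rewrite -[LHS](put_id x y).
    by move: txt'x tt; rewrite t'P put_l => ->; case: (t y) => // _; rewrite t'P.
  by rewrite !mulr0 addr0.
have [sxy|sxy] := boolP (s x == s y); have [s'xy|s'xy] := boolP (s' x == s' y).
- by rewrite /edge_update sxy s'xy eq_sym (negbTE ss') !mulr0.
- rewrite /edge_update sxy (negbTE s'xy) (diag _ _ false sxy s'xy) (diag _ _ true sxy s'xy).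
  by rewrite eq_sym (negbTE ss') !mulr0 addr0 mulr0.
- rewrite /edge_update s'xy (negbTE sxy) (diag _ _ false s'xy sxy) (diag _ _ true s'xy sxy).
  by rewrite (negbTE ss') !mulr0 addr0 mulr0.
case sx: (s x); case s'x: (s' x).
- by rewrite !same ?mulr0 // ?sx ?s'x // eq_sym.
- apply/esym/edge_update_rev_half => //; rewrite ?s'x ?sx //.
    by move: s'xy; rewrite s'x; case: (s' y).
  by move: sxy; rewrite sx; case: (s y).
- apply: edge_update_rev_half => //; rewrite ?s'x ?sx //.
    by move: sxy; rewrite sx; case: (s y).
  by move: s'xy; rewrite s'x; case: (s' y).
- by rewrite !same ?mulr0 // ?sx ?s'x // eq_sym.
Qed.

Definition gibbs (c : config n k) : R := ratio ^+ potential (val c).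

Lemma gibbs_sum_gt0 : 0 < \sum_c gibbs c.
Proof.
rewrite (bigD1 left_config) //= ltr_wpDr ?exprn_gt0 ?ratio_gt0 //.
by apply: sumr_ge0 => c _; rewrite exprn_ge0 // ltW // ratio_gt0.
Qed.

Lemma gibbs_stationary :
  is_stationary (exclusion n k beta) (fun c => gibbs c / \sum_c gibbs c).
Proof.
apply: reversible_stationary => [|c||c c'].
- exact: exclusion_sum1.
- by rewrite exprn_ge0 // ltW // ratio_gt0.
- exact: gibbs_sum_gt0.
rewrite /exclusion mulrCA [RHS]mulrCA; congr (_ * _); rewrite !mulr_sumr.
by apply: eq_bigr => e /eqP e12; apply: edge_update_rev.
Qed.

Lemma stationary_exclusion :
  is_stationary (exclusion n k beta) (stationary (exclusion n k beta)).
Proof. by apply: stationaryP; eexists; apply: gibbs_stationary. Qed.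

(** Both expectations stay within [C * r ^+ t] of the same evolved value, with [r < 1]. This lets
    the chosen law [stationary] be replaced by the Gibbs measure, whose symmetry can be used. *)
Lemma stationary_unique (mu nu : config n k -> R) (F : {ffun 'I_n -> bool} -> R) :
  is_stationary (exclusion n k beta) mu -> is_stationary (exclusion n k beta) nu ->
  (forall s, 0 <= F s <= 1) ->
  expect mu (fun c => F (val c)) = expect nu (fun c => F (val c)).
Proof.
move=> mustat nustat F01; set C : R := 2 * n%:R ^+ 4 * (alpha beta)^-1 ^+ (2 * n).
set r := 1 - delta n beta / n.-1%:R.
have osc mu' : is_stationary (exclusion n k beta) mu' -> forall t,
    `|iter t (evolve (exclusion n k beta)) (fun c => F (val c)) left_config
      - expect mu' (fun c => F (val c))| <= C * r ^+ t.
  move=> stat t; apply: iter_evolve_stationary => // c.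
  rewrite !iter_evolve_exclusion; apply: iter_gen_osc => //.
  by rewrite !cnt_full (eqP (valP c)) (eqP (valP left_config)).
set a := expect mu _; set b := expect nu _.
apply/eqP; rewrite -subr_eq0 -normr_eq0 eq_le normr_ge0 andbT leNgt; apply/negP => ab.
have r1 : `|r| < 1.
  rewrite ger0_norm ?rate_ge0 // ltrBlDr ltrDl divr_gt0 ?predn_gt0 //.
  rewrite /delta ltr_wpDl ?divr_ge0 ?sqr_ge0 // invr_gt0 exprn_gt0 // ltr0n.
  exact: ltnW.
have /cvgrPdist_lt/(_ _ (divr_gt0 ab (ltr0n R 2)))[N _ /(_ N (leqnn N))] :=
  cvg_geometric C r1.
rewrite /= sub0r normrN => CN; move: ab.
have := osc mu mustat N; have := osc nu nustat N; rewrite -/a -/b.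
set z := iter _ _ _ _ => zb za ab.
have : `|a - b| <= `|z - a| + `|z - b|.
  by rewrite -(subrKA z) [`|z - a|]distrC; apply: ler_normD.
have := ler_norm (C * r ^+ N); move: CN; rewrite /geometric /=; lra.
Qed.

Lemma max_dist_exclusion t :
  max_dist (exclusion n k beta) t <=
    2 * n%:R ^+ 4 * (alpha beta)^-1 ^+ (2 * n) * (1 - delta n beta / n.-1%:R) ^+ t.
Proof.
apply: max_dist_le => [||A c c'].
- by eexists; apply: gibbs_stationary.
- have a0 := alpha_gt0 beta01; have r0 := rate_ge0 n_gt1 beta01.
  have ai0 : 0 <= (alpha beta)^-1 by rewrite invr_ge0 ltW.
  by rewrite !mulr_ge0 // exprn_ge0.
(* The indicator of [A] is extended by zero to all sequences, where [gen] acts. *)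
pose F (s : {ffun 'I_n -> bool}) : R := [exists c, (c \in A) && (val c == s)]%:R.
have -> : (fun c => (c \in A)%:R) = (fun c => F (val c)).
  apply/funext => d; congr (_%:R); congr nat_of_bool; apply/idP/existsP => [dA|].
    by exists d; rewrite dA eqxx.
  by move=> [d' /andP[d'A /eqP/val_inj <-]].
rewrite !iter_evolve_exclusion; apply: iter_gen_osc => // [s|].
  by rewrite /F; case: [exists _, _]; rewrite lexx ler01.
by rewrite !cnt_full (eqP (valP c)) (eqP (valP c')).
Qed.

Lemma alphaV_le : (alpha beta)^-1 <= expR (2 * beta).
Proof.
case/andP: beta01 => b0 b1; have b1' : 0 < 1 + beta by lra.
apply: (@le_trans _ _ ((1 + beta) ^+ 2)).
  rewrite /alpha invf_div ler_pdivrMr; last by nra.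
  have : 2 <= (2 - beta ^+ 2) * (1 + beta) by nra.
  by rewrite expr2; nra.
rewrite expRM_natl; apply: lerXn2r; rewrite ?nnegrE ?expR_ge0 //.
  by rewrite ltW.
exact: expR_ge1Dx.
Qed.

(** The terms [4 * ln n] and [4 * beta * n] pay for the factors [n ^ 4] and [alpha ^ (-2 n)]; the
    remaining [4] leaves [2 * exp (-4) <= 1 / 8]. *)
Lemma max_dist_lt t :
  n%:R * (4 + 4 * ln n%:R + 4 * beta * n%:R) <= t%:R * delta n beta ->
  max_dist (exclusion n k beta) t < 1 / 4.
Proof.
case/andP: beta01 => b0 b1; set l := ln n%:R => tn.
have n0 : 0 < n%:R :> R by rewrite ltr0n ltnW.
have p0 := predn_gt0 R n_gt1.
apply: le_lt_trans (max_dist_exclusion t) _.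
have nE : n%:R ^+ 4 = expR (4 * l) :> R by rewrite expRM_natl lnK.
have aE : (alpha beta)^-1 ^+ (2 * n) <= expR (4 * beta * n%:R).
  have -> : 4 * beta * n%:R = (2 * n)%:R * (2 * beta) by rewrite natrM; ring.
  rewrite expRM_natl; apply: lerXn2r; rewrite ?nnegrE ?expR_ge0 ?alphaV_le //.
  by rewrite invr_ge0 ltW // alpha_gt0.
have rE : (1 - delta n beta / n.-1%:R) ^+ t <= expR (- (4 + 4 * l + 4 * beta * n%:R)).
  apply: (@le_trans _ _ (expR (- (delta n beta / n.-1%:R)) ^+ t)).
    by apply: lerXn2r; rewrite ?nnegrE ?expR_ge0 ?rate_ge0 // expR_ge1Dx.
  rewrite -expRM_natl ler_expR mulrN lerN2 mulrA ler_pdivlMr //.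
  have pn : n.-1%:R <= n%:R :> R by rewrite ler_nat leq_pred.
  have l0 : 0 <= l by rewrite ln_ge0 // ler1n ltnW.
  apply: le_trans tn; rewrite mulrC ler_wpM2r //.
  by rewrite addr_ge0 ?addr_ge0 ?mulr_ge0 // ltW.
apply: (@le_lt_trans _ _ (2 * expR (4 * l) * expR (4 * beta * n%:R) *
   expR (- (4 + 4 * l + 4 * beta * n%:R)))).
  rewrite nE; apply: ler_pM => //.
  - rewrite !mulr_ge0 ?expR_ge0 // exprn_ge0 // invr_ge0 ltW // alpha_gt0 //.
  - by rewrite exprn_ge0 // rate_ge0.
  - by rewrite ler_wpM2l // mulr_ge0 // expR_ge0.
have -> : 2 * expR (4 * l) * expR (4 * beta * n%:R) *
   expR (- (4 + 4 * l + 4 * beta * n%:R)) = 2 * expR (- 4).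
  by rewrite -!mulrA -!expRD; congr (_ * expR _); ring.
rewrite expRN; have e2 : 2 <= expR 1 :> R by have := expR_ge1Dx (1 : R); lra.
have : 2 ^+ 4 <= expR 4 :> R.
  by rewrite -[4 in X in _ <= X]mulr1 expRM_natl; apply: lerXn2r; rewrite ?nnegrE ?expR_ge0.
by move=> h; rewrite ltr_pdivrMr ?expR_gt0 //; lra.
Qed.

End Stationary.

(** * Left-right reversal of sequences *)

Section Reversal.
Variable n : nat.
Implicit Types (s : {ffun 'I_n -> bool}).

Definition reversal s : {ffun 'I_n -> bool} := [ffun i => s (rev_ord i)].

Lemma reversalK : involutive reversal.
Proof. by move=> s; apply/ffunP => i; rewrite !ffunE rev_ordK. Qed.

Lemma cnt_reversal s j : (j <= n)%N -> (cnt (reversal s) j + cnt s (n - j) = cnt s n)%N.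
Proof.
elim: j => [|j IHj] jn; first by rewrite cnt0 subn0.
rewrite -(IHj (ltnW jn)).
have := cntS (reversal s) (Ordinal jn); rewrite [reversal s _]ffunE => /= ->.
have := cntS s (rev_ord (Ordinal jn)); rewrite /= -subSn // subSS => ->.
by rewrite -!addnA; congr (_ + _)%N; rewrite addnC.
Qed.

Lemma cnt_reversal_full s : cnt (reversal s) n = cnt s n.
Proof. by rewrite -(cnt_reversal s (leqnn n)) subnn cnt0 addn0. Qed.

Lemma potential_reversal s :
  (potential (reversal s) + potential s = n.-1 * cnt s n)%N.
Proof.
rewrite /potential [X in (_ + X)%N]big_nat_rev -big_split /= -subn1 -sum_nat_const_nat.
rewrite big_nat_cond [RHS]big_nat_cond; apply: eq_bigr => j /andP[/andP[_ jn] _].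
by rewrite add1n subSS cnt_reversal // ltnW.
Qed.

Lemma cnt_mono s i j : (i <= j)%N -> (cnt s i <= cnt s j)%N.
Proof.
move=> ij; rewrite /cnt big_mkcond [leqRHS]big_mkcond; apply: leq_sum => x _.
by case: (ltnP x i) => // xi; rewrite (leq_trans xi ij).
Qed.

End Reversal.

(** * Lower bound from the speed of the particles *)

Section Ballistic.
Variables (R : realType) (n k : nat) (beta : R).
Hypotheses (n_gt1 : (1 < n)%N) (beta01 : 0 < beta < 1) (k_le : (k <= n)%N).
Implicit Types (s : {ffun 'I_n -> bool}) (x y : 'I_n) (c : config n k).

Local Notation pot s := ((potential s)%:R : R).

Definition drift : R := beta / 2 + (2 * n.-1%:R)^-1.

(** The symmetric part of the motion is a gradient, which telescopes over the path in [sum_gradient]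
    to a boundary term; only the bias costs something on every edge. *)
Lemma edge_avg_potential s x y : y = x.+1 :> nat ->
  ((s y)%:R - (s x)%:R) / 2 - beta / 2 <= edge_avg beta x y (fun s => pot s) s - pot s.
Proof.
case/andP: beta01 => b0 b1 yx; rewrite /edge_avg.
case sx: (s x); case sy: (s y) => /=.
- by rewrite !subrr mul0r sub0r oppr_le0 divr_ge0 // ltW.
- have nb : (false + true = s x + s y)%N by rewrite sx sy.
  have idb : put x y true false s = s by rewrite -[RHS](put_id x y) sx sy.
  have := potential_put yx nb; rewrite sx addn0 addn1 idb => <-.
  by rewrite -natr1; lra.
- have nb : (true + false = s x + s y)%N by rewrite sx sy.
  have idb : put x y false true s = s by rewrite -[RHS](put_id x y) sx sy.
  have := potential_put yx nb; rewrite sx addn0 addn1 idb => ->.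
  by rewrite -natr1; lra.
- by rewrite !subrr mul0r sub0r oppr_le0 divr_ge0 // ltW.
Qed.

Lemma sum_gradient s :
  -1 <= \sum_(e : 'I_n * 'I_n | (e.2 : nat) == e.1.+1) ((s e.2)%:R - (s e.1)%:R) :> R.
Proof.
(* [f j] is the value at site [j - 1], written through [cnt] so that it makes sense for every
   natural number and telescopes. *)
pose f (j : nat) : R := (cnt s j)%:R - (cnt s j.-1)%:R.
have -> : \sum_(e : 'I_n * 'I_n | (e.2 : nat) == e.1.+1) ((s e.2)%:R - (s e.1)%:R) =
          \sum_(e : 'I_n * 'I_n | (e.2 : nat) == e.1.+1) (f e.2.+1 - f e.2).
  apply: eq_bigr => e /eqP e12; rewrite /f /= cntS (cnt_edge s e12) e12 /= !natrD.
  by ring.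
rewrite (sum_edges n (fun j => f j.+1 - f j)) telescope_sumr ?(ltnW n_gt1) // /f /= cnt0 subr0.
have : (cnt s 1)%:R <= 1 :> R by rewrite lern1 cnt_leq.
have : (cnt s n.-1)%:R <= (cnt s n)%:R :> R by rewrite ler_nat cnt_mono // leq_pred.
by lra.
Qed.

Lemma gen_potential s : pot s - drift <= gen beta (fun s => pot s) s.
Proof.
suff : - drift <= gen beta (fun s => pot s) s - pot s by lra.
have pN0 : n.-1%:R != 0 :> R by rewrite gt_eqF ?predn_gt0.
rewrite gen_sub // -[- drift](mulKf pN0) ler_wpM2l ?invr_ge0 //.
apply: (@le_trans _ _ (\sum_(e : 'I_n * 'I_n | (e.2 : nat) == e.1.+1)
   (((s e.2)%:R - (s e.1)%:R) / 2 - beta / 2))); last first.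
  by apply: ler_sum => e /eqP e12; apply: edge_avg_potential.
rewrite sumrB -mulr_suml sum_edges_cst // /drift.
have := sum_gradient s; have := predn_gt0 R n_gt1.
set S := \sum_(e | _) _; move=> p0 S1.
have -> : n.-1%:R * - (beta / 2 + (2 * n.-1%:R)^-1) = - (n.-1%:R * (beta / 2)) - 2^-1 :> R.
  by field; rewrite gt_eqF.
by lra.
Qed.

Lemma law_potential c t :
  pot (val c) - t%:R * drift <= expect (law (exclusion n k beta) c t) (fun c => pot (val c)).
Proof.
have l0 := law_ge0 (fun c c' => exclusion_ge0 c c' beta01).
have l1 := law_sum1 (exclusion_sum1 (k := k) beta n_gt1).
elim: t => [|t IHt]; first by rewrite mul0r subr0 expect_law.
rewrite /law iterS expect_step -/(law _ _ t).
apply: (@le_trans _ _ (expect (law (exclusion n k beta) c t) (fun c => pot (val c) + (- drift)))).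
  rewrite expectD expect_cst ?l1 //; move: IHt; rewrite -natr1 mulrDl mul1r; lra.
apply: le_expect => [c'|c']; first exact: l0.
by rewrite (evolve_exclusion beta (fun s => pot s)) gen_potential.
Qed.

Lemma reversal_config_subproof c : (\sum_(i < n) reversal (val c) i)%N == k.
Proof. by rewrite -cnt_full cnt_reversal_full cnt_full (eqP (valP c)). Qed.

Definition reversal_config c : config n k :=
  exist _ (reversal (val c)) (reversal_config_subproof c).

Lemma cnt_config c : cnt (val c) n = k.
Proof. by rewrite cnt_full (eqP (valP c)). Qed.

Lemma pot_reversal c : pot (reversal (val c)) = n.-1%:R * k%:R - pot (val c).
Proof.
have := potential_reversal (val c); rewrite cnt_config => /(congr1 (fun m => m%:R : R)).
by rewrite natrD natrM => <-; rewrite addrK.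
Qed.

(* Among [c] and its reversal, the Gibbs weight favours the configuration of
   smaller potential. *)
Lemma stationary_potential :
  expect (stationary (exclusion n k beta)) (fun c => pot (val c)) <= n.-1%:R * k%:R / 2.
Proof.
have stat := stationary_exclusion n_gt1 beta01 k_le.
have gstat := gibbs_stationary n_gt1 beta01 k_le.
have n0 : 0 < n%:R :> R by rewrite ltr0n ltnW.
have F01 s : 0 <= (n%:R ^+ 2)^-1 * pot s <= 1.
  rewrite mulr_ge0 ?invr_ge0 ?exprn_ge0 //= ler_pdivrMl ?exprn_gt0 // mulr1.
  by rewrite -natrX -mulnn ler_nat potential_le.
have := stationary_unique n_gt1 beta01 k_le stat gstat F01; rewrite !expectZ.
move/mulfI => -> //; last by rewrite invr_eq0 expf_neq0 // gt_eqF.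
set m := n.-1%:R * k%:R / 2; set Z := \sum_(c : config n k) gibbs beta c.
have Z0 : 0 < Z by apply: gibbs_sum_gt0.
have -> : expect (fun c : config n k => gibbs beta c / Z) (fun c => pot (val c)) =
          (\sum_(c : config n k) gibbs beta c * pot (val c)) / Z.
  by rewrite /expect mulr_suml; apply: eq_bigr => c _; rewrite mulrAC.
rewrite ler_pdivrMr // -subr_le0 mulrC mulr_suml -sumrB.
under eq_bigr do rewrite -mulrBr.
set S := \sum_c _; suff : S + S <= 0 by lra.
have revK : injective reversal_config.
  by move=> c c' /(congr1 val) /(inv_inj (@reversalK n)) /val_inj.
rewrite {1}/S (reindex_inj revK) -big_split /=; apply: sumr_le0 => c _.
rewrite /gibbs /= pot_reversal.
have r0 := ratio_gt0 beta01.
have r1 : ratio beta <= 1.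
  by case/andP: beta01 => b0 b1; rewrite /ratio ler_pdivrMr; lra.
have -> : n.-1%:R * k%:R - pot (val c) - m = - (pot (val c) - m) by rewrite /m; field.
rewrite mulrN addrC -mulrBl; have [le|lt] := leP m (pot (val c)).
  rewrite mulr_le0_ge0 ?subr_ge0 // subr_le0.
  apply: ler_wiXn2l => //; first exact: ltW.
  by rewrite -(ler_nat R) pot_reversal; move: le; rewrite /m; lra.
apply: mulr_ge0_le0; last by rewrite subr_le0 ltW.
rewrite subr_ge0.
apply: ler_wiXn2l => //; first exact: ltW.
by rewrite -(ler_nat R) pot_reversal; move: lt; rewrite /m; lra.
Qed.

Lemma potential_left_max c : pot (val c) <= pot (left_packed n k).
Proof.
rewrite ler_nat /potential big_nat_cond [leqRHS]big_nat_cond.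
apply: leq_sum => j /andP[/andP[_ jn] _]; rewrite cnt_left_packed ?(ltnW jn) //.
by rewrite leq_min cnt_leq -[leqRHS](cnt_config c) cnt_mono // ltnW.
Qed.

(** Maximum minus minimum of the potential: the maximum is at the left-packed configuration, the
    minimum at its reversal. *)
Definition potential_range : R := 2 * pot (left_packed n k) - n.-1%:R * k%:R.

(** The range is the sum over [j] of the gap between the two extreme height functions; for [j <= J]
    this gap is [j], which gives [J (J + 1) / 2]. *)
Lemma potential_range_ge (J : nat) : (J <= k)%N -> (J <= n - k)%N -> J%:R ^+ 2 / 2 <= potential_range.
Proof.
move=> Jk Jnk.
have -> : potential_range = (\sum_(1 <= j < n) (minn j k + minn (n - j) k - k)%N)%:R.
  have kk j : (j < n)%N -> (k <= minn j k + minn (n - j) k)%N.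
    by move: k_le; lia.
  have : (\sum_(1 <= j < n) (minn j k + minn (n - j) k - k) + n.-1 * k
          = potential (left_packed n k) + potential (left_packed n k))%N.
    rewrite -subn1 -sum_nat_const_nat -big_split /=.
    rewrite /potential [X in (_ = _ + X)%N]big_nat_rev -big_split /=.
    rewrite big_nat_cond [RHS]big_nat_cond; apply: eq_bigr => j /andP[/andP[j1 jn] _].
    rewrite add1n subSS subnK ?kk // !cnt_left_packed ?leq_subr //; exact: ltnW.
  move=> /(congr1 (fun m => m%:R : R)); rewrite !natrD natrM /potential_range => e.
  by rewrite mulr_natl mulr2n -e addrK.
have J2 : (J.+1 <= n)%N by lia.
apply: (@le_trans _ _ (\sum_(1 <= j < J.+1) j)%:R).
  rewrite ler_pdivrMr // -natrX -natrM ler_nat.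
  elim: J {Jk Jnk J2} => // J IHJ; rewrite big_nat_recr //= mulnDl.
  by move: IHJ; rewrite -!mulnn; lia.
rewrite ler_nat [leqRHS](big_cat_nat (n := J.+1)) //=; apply: leq_trans (leq_addr _ _).
rewrite big_nat_cond [leqRHS]big_nat_cond; apply: leq_sum => j /andP[/andP[j1 jJ] _].
by move: jJ Jk Jnk; lia.
Qed.

(** The potential starts half a range above the midpoint, and its stationary mean is at most the
    midpoint. A distance below [1 / 4] lets the means differ by at most a quarter of the range, so
    the drift must cover the other quarter. *)
Lemma ballistic_lower_bound (J t : nat) : (J <= k)%N -> (J <= n - k)%N ->
  max_dist (exclusion n k beta) t < 1 / 4 -> J%:R ^+ 2 / 8 <= t%:R * drift.
Proof.
move=> Jk Jnk dt; have rg := potential_range_ge Jk Jnk.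
have l1 := law_sum1 (exclusion_sum1 (k := k) beta n_gt1).
have [_ pi1 _] := stationary_exclusion n_gt1 beta01 k_le.
pose m0 : R := n.-1%:R * k%:R - pot (left_packed n k).
have range0 : 0 <= potential_range by apply: le_trans rg; rewrite divr_ge0 ?exprn_ge0.
have f01 c : 0 <= pot (val c) + (- m0) <= potential_range.
  have := potential_left_max c; have := potential_left_max (reversal_config c).
  rewrite /= pot_reversal /m0 /potential_range => h1 h2; apply/andP; split; lra.
have := expect_tv_dist (law (exclusion n k beta) (left_config k_le) t)
          (stationary (exclusion n k beta)) range0 f01.
rewrite !expectD !expect_cst ?l1 //.
have := le_max_dist (exclusion n k beta) (left_config k_le) t.
set tv := tv_dist _ _; move=> tvd h.
have tv14 : potential_range * tv <= potential_range * (1 / 4) by rewrite ler_wpM2l // ltW // (le_lt_trans tvd).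
have := law_potential (left_config k_le) t; have := stationary_potential.
move: h tv14 rg; rewrite /potential_range /=; lra.
Qed.

End Ballistic.

(** * Elementary bounds for sine and cosine *)

Section Trigonometry.
Variable R : realType.
Implicit Types x : R.

Lemma sin_mulrn_le (m : nat) x : `|sin (m%:R * x)| <= m%:R * `|sin x|.
Proof.
elim: m => [|m IHm]; first by rewrite !mul0r sin0 normr0.
rewrite -natr1 !mulrDl !mul1r sinD; apply: le_trans (ler_normD _ _) _.
rewrite !normrM lerD //.
  by apply: le_trans IHm; rewrite ler_piMr // cos_max.
by rewrite ler_piMl // cos_max.
Qed.

Lemma sin_half_mesh (n : nat) : (0 < n)%N -> n%:R^-1 <= sin (pi / (2 * n%:R)) :> R.
Proof.
move=> n0; have n0' : 0 < n%:R :> R by rewrite ltr0n.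
have p0 : 0 < pi / (2 * n%:R) :> R by rewrite divr_gt0 ?pi_gt0 ?mulr_gt0.
have p2 : pi / (2 * n%:R) <= pi :> R.
  rewrite ler_pdivrMr ?mulr_gt0 // ler_peMr ?pi_ge0 //.
  by have : 1 <= n%:R :> R by [rewrite ler1n]; lra.
have s0 : 0 <= sin (pi / (2 * n%:R)) :> R by rewrite sin_ge0_pi // ltW.
have := sin_mulrn_le n (pi / (2 * n%:R)).
have -> : n%:R * (pi / (2 * n%:R)) = pi / 2 :> R by field; rewrite gt_eqF.
by rewrite sin_pihalf normr1 (ger0_norm s0) -ler_pdivrMl // mulr1.
Qed.

Lemma sin_le_id x : 0 <= x -> sin x <= x.
Proof.
move=> x0; have := @MVT_segment R sin cos 0 x x0.
case=> [|c _]; first by apply: continuous_subspaceT; apply: continuous_sin.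
by rewrite sin0 !subr0 => ->; rewrite ler_piMl // cos_le1.
Qed.

Lemma cos_mesh (n : nat) : (0 < n)%N ->
  2 / n%:R ^+ 2 <= 1 - cos (pi / n%:R : R) <= 8 / n%:R ^+ 2.
Proof.
move=> n0; have n0' : 0 < n%:R :> R by rewrite ltr0n.
set z : R := pi / (2 * n%:R).
have -> : pi / n%:R = z *+ 2 :> R by rewrite /z mulr2n; field; rewrite gt_eqF.
have z0 : 0 <= z by rewrite divr_ge0 ?pi_ge0 ?mulr_ge0.
have sz := sin_half_mesh n0; have szz := sin_le_id z0.
have z_le : z <= 2 / n%:R.
  rewrite /z ler_pdivrMr ?mulr_gt0 //.
  have -> : 2 / n%:R * (2 * n%:R) = 4 :> R by field; rewrite gt_eqF.
  by have := pihalf_lt2 R; lra.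
have -> : 1 - cos (z *+ 2) = 2 * sin z ^+ 2 by rewrite cos_mulr2n cos2sin2; ring.
have i0 : 0 <= n%:R^-1 :> R by rewrite invr_ge0.
have -> : 2 / n%:R ^+ 2 = 2 * (n%:R^-1) ^+ 2 :> R by rewrite exprVn.
have -> : 8 / n%:R ^+ 2 = 2 * (2 / n%:R) ^+ 2 :> R by field; rewrite gt_eqF.
have s0 : 0 <= sin z by apply: le_trans sz.
have n2 : 0 <= 2 / n%:R :> R by rewrite divr_ge0.
apply/andP; split; rewrite ler_wpM2l //; apply: lerXn2r; rewrite ?nnegrE //.
exact: le_trans z_le.
Qed.

End Trigonometry.

(** * The exact eigenfunction and its second moment *)

Section Eigenfunction.
Variables (R : realType) (n k : nat) (beta : R).
Hypotheses (n_gt1 : (1 < n)%N) (beta01 : 0 < beta < 1).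
Implicit Types (s : {ffun 'I_n -> bool}) (x y : 'I_n).

Definition odds : R := (1 + beta) / (1 - beta).

Local Notation lam := odds.
Local Notation p := ((1 + beta) / 2).
Local Notation q := ((1 - beta) / 2).

Definition profile (j : nat) : R := (Num.sqrt lam)^-1 ^+ j * sin (pi / n%:R * j%:R).

Definition harmonic (j : nat) : R := 1 + (lam ^+ k - 1) / (lam ^+ n - 1) * (lam ^+ j - 1).

(* The Gaertner (discrete Cole-Hopf) transform [lam ^+ cnt s j] solves a linear
   equation with boundary values [1] and [lam ^+ k]; subtracting the stationary
   solution [harmonic] makes the boundary values vanish. *)
Definition gartner s (j : nat) : R := lam ^+ cnt s j - harmonic j.

Definition eigenfun s : R := \sum_(1 <= j < n) profile j * gartner s j.

(** Here [(1 - beta) * sqrt odds = 2 * sqrt (p * q)], so one minus this gap is the largest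
    eigenvalue of a walk with rates [p] and [q] killed at [0] and [n]. *)
Definition edge_gap : R := 1 - (1 - beta) * Num.sqrt lam * cos (pi / n%:R).

Definition gap : R := edge_gap / n.-1%:R.

Lemma odds_gt1 : 1 < lam.
Proof. by case/andP: beta01 => b0 b1; rewrite ltr_pdivlMr; lra. Qed.

Let lam_gt0 : 0 < lam. Proof. exact: lt_trans odds_gt1. Qed.

Let sq_gt0 : 0 < Num.sqrt lam. Proof. by rewrite sqrtr_gt0. Qed.

Lemma odds_harmonic (m : nat) : q * lam ^+ m.+2 + p * lam ^+ m = lam ^+ m.+1.
Proof.
case/andP: beta01 => b0 b1; rewrite !exprS.
have -> : q * (lam * (lam * lam ^+ m)) + p * lam ^+ m = (q * lam * lam + p) * lam ^+ m by ring.
by congr (_ * _); rewrite /odds; field; rewrite gt_eqF //; lra.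
Qed.

Lemma harmonic_eq (j : nat) : (0 < j)%N ->
  q * harmonic j.+1 + p * harmonic j.-1 = harmonic j.
Proof.
case: j => // j _ /=; rewrite /harmonic -[in RHS]odds_harmonic.
move: (_ / (lam ^+ n - 1)) (lam ^+ j.+2) (lam ^+ j) => B u v; lra.
Qed.

Lemma gartner0 s : gartner s 0 = 0.
Proof. by rewrite /gartner /harmonic cnt0 !expr0 subrr mulr0 addr0 subrr. Qed.

Lemma gartner_full s : cnt s n = k -> gartner s n = 0.
Proof.
move=> sk; rewrite /gartner /harmonic sk divfK ?[1 + _]addrC ?subrK ?subrr //.
by rewrite subr_eq0 gt_eqF // exprn_egt1 ?odds_gt1 // -lt0n ltnW.
Qed.

Lemma eigenfun_put s x y (a b : bool) : y = x.+1 :> nat -> (a + b = s x + s y)%N ->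
  eigenfun (put x y a b s) - eigenfun s = profile y * (lam ^+ (cnt s x + a) - lam ^+ cnt s y).
Proof.
move=> yx ab; rewrite /eigenfun.
have yI : (y : nat) \in index_iota 1 n by rewrite mem_index_iota yx ltnS leq0n -yx ltn_ord.
rewrite !(bigD1_seq (y : nat) yI (iota_uniq _ _)) /= /gartner.
rewrite cnt_put // eqxx; under eq_bigr => j /negbTE jy do rewrite cnt_put // jy.
by ring.
Qed.

(** The choice [odds = p / q] makes the exclusion rule linear: [1] and [odds] are the roots of
    [q z ^ 2 - z + p], so the right-hand side vanishes on a full edge, where nothing moves. On a
    vacant edge this is [p + q = 1], and on mixed edges the two sides agree by direct
    computation. *)
Lemma edge_avg_eigenfun s x y : y = x.+1 :> nat ->
  edge_avg beta x y eigenfun s - eigenfun s =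
  profile y * (q * gartner s y.+1 + p * gartner s y.-1 - gartner s y).
Proof.
move=> yx; have [b0 b1] := andP beta01.
have y0 : (0 < y)%N by rewrite yx.
have -> : q * gartner s y.+1 + p * gartner s y.-1 - gartner s y =
   q * lam ^+ cnt s y.+1 + p * lam ^+ cnt s y.-1 - lam ^+ cnt s y.
  by rewrite /gartner -[in harmonic y](harmonic_eq y0); ring.
have qlam m : q * lam ^+ m.+1 = p * lam ^+ m.
  by rewrite exprS /odds; field; rewrite gt_eqF //; lra.
rewrite cntS (cnt_edge s yx) {2}yx /= /edge_avg.
case sx: (s x); case sy: (s y) => /=; rewrite ?addn0 ?addn1.
- by rewrite odds_harmonic !subrr mulr0.
- have nb : (false + true = s x + s y)%N by rewrite sx sy.
  have idb : put x y true false s = s by rewrite -[RHS](put_id x y) sx sy.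
  have := eigenfun_put yx nb; rewrite idb (cnt_edge s yx) sx addn0 addn1 => e.
  have -> : p * eigenfun (put x y false true s) + q * eigenfun s - eigenfun s =
            p * (eigenfun (put x y false true s) - eigenfun s) by field.
  by rewrite e; field.
- have nb : (true + false = s x + s y)%N by rewrite sx sy.
  have idb : put x y false true s = s by rewrite -[RHS](put_id x y) sx sy.
  have := eigenfun_put yx nb; rewrite idb (cnt_edge s yx) sx addn0 addn1 => e.
  have -> : p * eigenfun s + q * eigenfun (put x y true false s) - eigenfun s =
            q * (eigenfun (put x y true false s) - eigenfun s) by field.
  by rewrite e; field.
- by rewrite subrr; have -> : q * lam ^+ cnt s x + p * lam ^+ cnt s x - lam ^+ cnt s x = 0; [field | rewrite mulr0].
Qed.

(** The adjoint of the operator on [gartner]. As [p = q * sqrt odds ^ 2], the powers of [sqrt odds]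
    symmetrize it, and the addition formulas do the rest. *)
Lemma profile_eq (j : nat) : (0 < j)%N ->
  q * profile j.-1 + p * profile j.+1 = (1 - edge_gap) * profile j.
Proof.
case: j => // j _ /=; have [b0 b1] := andP beta01; rewrite /profile /edge_gap.
set r := Num.sqrt lam; set th := pi / n%:R.
have r2 : r ^+ 2 = lam by rewrite sqr_sqrtr // ltW.
have rN0 : r != 0 by rewrite gt_eqF.
have pr : p = q * r ^+ 2 by rewrite r2 /odds; field; rewrite gt_eqF //; lra.
have -> : th * j%:R = th * j.+1%:R - th by rewrite -natr1; ring.
have -> : th * j.+2%:R = th * j.+1%:R + th by rewrite -[j.+2%:R]natr1; ring.
rewrite sinB sinD pr !exprS; field.
by rewrite rN0.
Qed.

Lemma profile0 : profile 0 = 0.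
Proof. by rewrite /profile mulr0 sin0 mulr0. Qed.

Lemma profile_full : profile n = 0.
Proof. by rewrite /profile divfK ?sinpi ?mulr0 // pnatr_eq0 -lt0n ltnW. Qed.

Lemma gen_eigenfun s : cnt s n = k -> gen beta eigenfun s = (1 - gap) * eigenfun s.
Proof.
move=> sk; have pN0 : n.-1%:R != 0 :> R by rewrite gt_eqF ?predn_gt0.
have n1 : (1 <= n)%N by rewrite ltnW.
suff h : gen beta eigenfun s - eigenfun s = - gap * eigenfun s.
  by rewrite -[LHS](subrK (eigenfun s)) h; ring.
rewrite gen_sub // /gap (mulrC edge_gap) -mulrN -mulrA; congr (_ * _).
have -> : \sum_(e : 'I_n * 'I_n | (e.2 : nat) == e.1.+1)
     (edge_avg beta e.1 e.2 eigenfun s - eigenfun s) =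
   \sum_(1 <= j < n) profile j * (q * gartner s j.+1 + p * gartner s j.-1 - gartner s j).
  rewrite -(sum_edges n (fun j => profile j * (q * gartner s j.+1 + p * gartner s j.-1 - gartner s j))).
  by apply: eq_bigr => e /eqP e12; apply: edge_avg_eigenfun.
(* Summation by parts moves the operator from [gartner] to [profile]; the telescoping terms [a] and
   [b] vanish by the boundary zeros of both factors. *)
pose a (j : nat) := profile j.-1 * gartner s j.
pose b (j : nat) := profile j * gartner s j.-1.
have sa : \sum_(1 <= j < n) (a j.+1 - a j) = 0.
  by rewrite telescope_sumr // /a /= profile0 mul0r gartner_full // mulr0 subrr.
have sb : \sum_(1 <= j < n) (b j.+1 - b j) = 0.
  by rewrite telescope_sumr // /b /= gartner0 mulr0 profile_full mul0r subrr.
have -> : \sum_(1 <= j < n) profile j * (q * gartner s j.+1 + p * gartner s j.-1 - gartner s j)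
   = \sum_(1 <= j < n) (q * (a j.+1 - a j) + - p * (b j.+1 - b j)
       + - edge_gap * (profile j * gartner s j)).
  rewrite big_nat_cond [RHS]big_nat_cond; apply: eq_bigr => j /andP[/andP[j1 _] _].
  have := profile_eq j1; rewrite /a /b /= => pe.
  have -> : - edge_gap * (profile j * gartner s j) =
     ((1 - edge_gap) * profile j - profile j) * gartner s j by ring.
  by rewrite -pe; ring.
by rewrite !big_split /= -!mulr_sumr sa sb !mulr0 !add0r.
Qed.

Lemma profile_norm (j : nat) : `|profile j| <= 1.
Proof.
have i0 : 0 <= (Num.sqrt lam)^-1 by rewrite invr_ge0 ltW.
rewrite /profile normrM ger0_norm ?exprn_ge0 // mulr_ile1 ?sin_max ?exprn_ge0 //.
rewrite exprn_ile1 // invf_le1 // -[leLHS]sqrtr1; apply: ler_wsqrtr; exact: ltW odds_gt1.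
Qed.

(** The factor [odds - 1] is kept apart: it cancels against the same factor in
    [eigenfun_left_packed]. *)
Definition jump : R := (lam - 1) * lam ^+ n.

Lemma eigenfun_put_sqr s x y (a b : bool) : y = x.+1 :> nat -> (a + b = s x + s y)%N ->
  (eigenfun (put x y a b s) - eigenfun s) ^+ 2 <= jump ^+ 2.
Proof.
move=> yx ab; have l1 := odds_gt1.
rewrite (eigenfun_put yx ab) (cnt_edge s yx) !exprD -mulrBr.
rewrite -real_normK ?num_real // -[leRHS]real_normK ?num_real //.
apply: lerXn2r; rewrite ?nnegrE // !normrM.
have lm0 : 0 <= lam - 1 by rewrite subr_ge0 ltW.
have lx0 (m : nat) : 0 <= lam ^+ m by rewrite exprn_ge0 // ltW.
apply: (@le_trans _ _ (1 * (`|lam ^+ cnt s x| * `|lam - 1|))); last first.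
  rewrite mul1r mulrC ger0_norm // ger0_norm // ger0_norm ?mulr_ge0 // (ler_wpM2l lm0) //.
  by apply: ler_weXn2l; [exact: ltW | exact: leq_trans (cnt_leq s x) (ltnW _)].
apply: ler_pM => //; first by rewrite -normrM; apply: profile_norm.
apply: ler_wpM2l => //.
by case: a {ab}; case: (s x); rewrite ?expr1 ?expr0 ?subrr ?normr0 // distrC.
Qed.

Lemma gen_eigenfun_sqr s : cnt s n = k ->
  gen beta (fun s => eigenfun s ^+ 2) s <= (1 - gap *+ 2) * eigenfun s ^+ 2 + jump ^+ 2.
Proof.
move=> sk; have p0 := predn_gt0 R n_gt1; have [b0 b1] := andP beta01.
have := gen_eigenfun sk; rewrite -[LHS](subrK (eigenfun s)) gen_sub //.
set S := \sum_(e | _) _ => eS.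
suff h : gen beta (fun s => eigenfun s ^+ 2) s - eigenfun s ^+ 2 <=
   2 * eigenfun s * ((n.-1%:R)^-1 * S) + jump ^+ 2.
  have e' : (n.-1%:R)^-1 * S = - gap * eigenfun s by lra.
  by move: h; rewrite e' mulr2n; lra.
have pN0 : n.-1%:R != 0 :> R by rewrite gt_eqF.
rewrite gen_sub // mulrCA -[jump ^+ 2](mulKf pN0) -mulrDr.
rewrite ler_wpM2l ?invr_ge0 // -sum_edges_cst // /S mulr_sumr -big_split /=.
apply: ler_sum => e /eqP e12; rewrite /edge_avg.
case: ifP => [_|/negbT ne]; first by rewrite !subrr mulr0 add0r sqr_ge0.
have e1 := @eigenfun_put_sqr s e.1 e.2 false true e12.
have e2 := @eigenfun_put_sqr s e.1 e.2 true false e12.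
have nb : (false + true = s e.1 + s e.2)%N by case: (s e.1) (s e.2) ne => [] [].
move: (e1 nb) (e2 nb); set A := eigenfun (put _ _ false _ _).
set B := eigenfun (put _ _ true _ _); set Z := eigenfun s; set J := jump ^+ 2.
move=> hA hB.
have -> : p * A ^+ 2 + q * B ^+ 2 - Z ^+ 2 =
   2 * Z * (p * A + q * B - Z) + (p * (A - Z) ^+ 2 + q * (B - Z) ^+ 2) by field.
rewrite lerD2l; have -> : J = p * J + q * J by field.
by rewrite lerD // ler_wpM2l //; lra.
Qed.

End Eigenfunction.

(** * Wilson's lower bound from the left-packed configuration *)

Section WilsonBound.
Variables (R : realType) (n k : nat) (beta : R).
Hypotheses (n_gt1 : (1 < n)%N) (beta01 : 0 < beta < 1) (k_le : (k <= n)%N).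

Local Notation lam := (odds beta).

(** With [h = sqrt (1 - beta ^ 2)] and [c = cos (pi / n)], the gap [1 - h c] is at least [1 - c];
    the upper bound uses [1 - h <= 1 - h ^ 2 = beta ^ 2]. *)
Lemma edge_gap_bounds :
  2 / n%:R ^+ 2 <= edge_gap n beta <= beta ^+ 2 + 8 / n%:R ^+ 2.
Proof.
have [b0 b1] := andP beta01; have l0 : 0 < lam := lt_trans ltr01 (odds_gt1 beta01).
have n0 : 0 < n%:R :> R by rewrite ltr0n ltnW.
have /andP[c_le c_ge] := cos_mesh R (ltnW n_gt1).
rewrite /edge_gap; set c := cos _ in c_le c_ge *; set h := (1 - beta) * _.
have h0 : 0 <= h by rewrite mulr_ge0 ?sqrtr_ge0 //; lra.
have h2 : h ^+ 2 = 1 - beta ^+ 2.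
  rewrite /h exprMn sqr_sqrtr ?(ltW l0) // /odds; field; rewrite gt_eqF //; lra.
have h1 : h <= 1 by nra.
have c0 : 0 <= c.
  apply: cos_ge0_pihalf; have p0 := pi_gt0 R; have n2 : 2 <= n%:R :> R by rewrite ler_nat.
  have t0 : 0 <= pi / n%:R :> R by rewrite divr_ge0 ?pi_ge0.
  apply/andP; split; first by lra.
  by rewrite ler_pM2l ?pi_gt0 // lef_pV2 ?posrE.
have c1 : c <= 1 by apply: cos_le1.
by apply/andP; split; nra.
Qed.

Lemma expr_sub1_ge (m : nat) : m%:R * (lam - 1) <= lam ^+ m - 1.
Proof.
have l1 := odds_gt1 beta01; elim: m => [|m IHm]; first by rewrite mul0r expr0 subrr.
have : 1 <= lam ^+ m by rewrite exprn_ege1 // ltW.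
by rewrite -natr1 exprSr; nra.
Qed.

Lemma expr_sub1_le (m : nat) : lam ^+ m - 1 <= m%:R * (lam - 1) * lam ^+ m.
Proof.
have l1 := odds_gt1 beta01; elim: m => [|m IHm]; first by rewrite !mul0r expr0 subrr.
have m0 : 0 <= m%:R :> R by [].
have lm1 : 1 <= lam ^+ m by rewrite exprn_ege1 // ltW.
have : 0 <= m%:R * (lam - 1) * lam ^+ m * (lam - 1) by rewrite !mulr_ge0 //; lra.
have : 0 <= (lam - 1) * lam ^+ m * (lam - 1) by rewrite !mulr_ge0 //; lra.
by rewrite -natr1 exprSr; lra.
Qed.

Lemma gartner_left_packed_ge0 j : (j <= n)%N -> 0 <= gartner k beta (left_packed n k) j.
Proof.
move=> jn; have l1 := odds_gt1 beta01; have lw : 1 <= lam := ltW l1.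
have Ln : 0 < lam ^+ n - 1 by rewrite subr_gt0 exprn_egt1 // -lt0n ltnW.
have mono (a b : nat) : (a <= b)%N -> lam ^+ a <= lam ^+ b by apply: ler_weXn2l.
have ge1 a : 1 <= lam ^+ a by rewrite exprn_ege1.
rewrite /gartner /harmonic cnt_left_packed //.
have -> : lam ^+ minn j k - (1 + (lam ^+ k - 1) / (lam ^+ n - 1) * (lam ^+ j - 1)) =
   ((lam ^+ minn j k - 1) * (lam ^+ n - 1) - (lam ^+ k - 1) * (lam ^+ j - 1)) / (lam ^+ n - 1).
  by field; rewrite gt_eqF.
rewrite divr_ge0 ?(ltW Ln) // subr_ge0; have [jk|kj] := leqP j k.
  by rewrite mulrC ler_wpM2l ?subr_ge0 // lerD2r mono.
by rewrite ler_wpM2l ?subr_ge0 // lerD2r mono.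
Qed.

Lemma gartner_left_packed_ge j : (j <= k)%N -> (4 * k <= 3 * n)%N ->
  j%:R / 4 * (lam - 1) / lam ^+ n <= gartner k beta (left_packed n k) j.
Proof.
move=> jk k34; have l1 := odds_gt1 beta01; have lw : 1 <= lam := ltW l1.
have jn : (j <= n)%N := leq_trans jk k_le.
have Ln : 0 < lam ^+ n - 1 by rewrite subr_gt0 exprn_egt1 // -lt0n ltnW.
have ln0 : 0 < lam ^+ n by rewrite exprn_gt0 // (lt_trans _ l1).
rewrite /gartner /harmonic cnt_left_packed // (minn_idPl jk).
have -> : lam ^+ j - (1 + (lam ^+ k - 1) / (lam ^+ n - 1) * (lam ^+ j - 1)) =
   (lam ^+ j - 1) * (lam ^+ n - lam ^+ k) / (lam ^+ n - 1).
  by field; rewrite gt_eqF.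
rewrite ler_pdivlMr //.
have n0 : 0 < n%:R :> R by rewrite ltr0n ltnW.
have lm0 : 0 <= lam - 1 by rewrite subr_ge0.
have hk : n%:R / 4 * (lam - 1) <= lam ^+ n - lam ^+ k.
  apply: (@le_trans _ _ ((n - k)%:R * (lam - 1))).
    rewrite ler_wpM2r // natrB //.
    have : (4 * k)%:R <= (3 * n)%:R :> R by rewrite ler_nat.
    by rewrite !natrM; lra.
  have -> : lam ^+ n - lam ^+ k = lam ^+ k * (lam ^+ (n - k) - 1).
    by rewrite mulrBr mulr1 -exprD subnKC.
  by apply: le_trans (expr_sub1_ge _) _; rewrite ler_peMl ?subr_ge0 ?exprn_ege1.
apply: (@le_trans _ _ (j%:R * (lam - 1) * (n%:R / 4 * (lam - 1)))).
  apply: (@le_trans _ _ (j%:R / 4 * (lam - 1) / lam ^+ n * (n%:R * (lam - 1) * lam ^+ n))).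
    by rewrite ler_wpM2l ?expr_sub1_le // divr_ge0 ?mulr_ge0 ?(ltW ln0).
  by rewrite le_eqVlt; apply/orP; left; apply/eqP; field; rewrite gt_eqF.
by apply: ler_pM => //; rewrite ?mulr_ge0 ?expr_sub1_ge.
Qed.

(** All terms are nonnegative for the left-packed configuration, so it suffices to keep the window
    [J <= j < 2 J], on which the sine is bounded below. *)
Lemma eigenfun_left_packed (sigma : R) (J : nat) :
  0 <= sigma -> (0 < J)%N -> (2 * J <= k)%N -> (4 * k <= 3 * n)%N ->
  (forall j, (J <= j < 2 * J)%N -> sigma <= sin (pi / n%:R * j%:R)) ->
  sigma * J%:R ^+ 2 / 4 * ((lam - 1) / (lam ^+ n) ^+ 2) <= eigenfun k beta (left_packed n k).
Proof.
move=> s0 J0 J2k k34 sinJ; have l1 := odds_gt1 beta01; have lw : 1 <= lam := ltW l1.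
have n0 : 0 < n%:R :> R by rewrite ltr0n ltnW.
have J2n : (2 * J <= n)%N := leq_trans J2k k_le.
have JJ : (J <= 2 * J)%N by rewrite mul2n -addnn leq_addr.
have lm0 : 0 <= lam - 1 by rewrite subr_ge0.
have ln0 : 0 < lam ^+ n by rewrite exprn_gt0 // (lt_trans _ l1).
have lam0 : 0 < lam := lt_trans ltr01 l1.
have sq0 : 0 < Num.sqrt lam by rewrite sqrtr_gt0.
have prof0 j : (j <= n)%N -> 0 <= profile n beta j.
  move=> jn; rewrite /profile mulr_ge0 ?exprn_ge0 ?invr_ge0 ?(ltW sq0) //.
  apply: sin_ge0_pi; rewrite mulr_ge0 ?divr_ge0 ?pi_ge0 //= mulrAC ler_pdivrMr //.
  by rewrite ler_wpM2l ?pi_ge0 // ler_nat.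
have term0 a b : (b <= n)%N ->
    0 <= \sum_(a <= j < b) profile n beta j * gartner k beta (left_packed n k) j.
  move=> bn; rewrite big_nat_cond; apply: sumr_ge0 => j /andP[/andP[_ jb] _].
  by rewrite mulr_ge0 ?prof0 ?gartner_left_packed_ge0 // ltnW ?(leq_trans jb).
rewrite /eigenfun (big_cat_nat (n := J)) ?(leq_trans JJ) //=.
rewrite (big_cat_nat (m := J) (n := (2 * J)%N)) //= addrCA.
apply: ler_wpDr; first by rewrite addr_ge0 ?term0 // (leq_trans JJ).
apply: (@le_trans _ _ (\sum_(J <= j < 2 * J) (sigma / lam ^+ n * (J%:R / 4 * (lam - 1) / lam ^+ n)))).
  rewrite sumr_const_nat -mulr_natl mul2n -addnn addnK.
  by rewrite le_eqVlt; apply/orP; left; apply/eqP; field; rewrite gt_eqF.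
apply: ler_sum_nat => j /andP[Jj jJ].
have jk : (j <= k)%N := leq_trans (ltnW jJ) J2k.
have gj := gartner_left_packed_ge jk k34.
apply: ler_pM.
- by rewrite divr_ge0 // ltW.
- by rewrite divr_ge0 ?(ltW ln0) // mulr_ge0 // divr_ge0.
- rewrite /profile mulrC; apply: ler_pM => //; first by rewrite invr_ge0 ltW.
    rewrite exprVn lef_pV2 ?posrE ?exprn_gt0 //.
    apply: (@le_trans _ _ (lam ^+ j)); last first.
      by apply: ler_weXn2l => //; apply: leq_trans k_le.
    apply: lerXn2r; rewrite ?nnegrE ?(ltW sq0) ?(ltW lam0) //.
    have sl2 : Num.sqrt lam ^+ 2 = lam by rewrite sqr_sqrtr // ltW.
    have sl1 : 1 <= Num.sqrt lam by rewrite -[leLHS]sqrtr1 ler_wsqrtr.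
    by rewrite -[leRHS]sl2 expr2 ler_peMl // ltW.
  by apply: sinJ; rewrite Jj jJ.
- apply: le_trans gj; rewrite ler_wpM2r ?invr_ge0 ?(ltW ln0) // ler_wpM2r //.
  by rewrite ler_wpM2r // ler_nat.
Qed.

(** The squared initial value has order [J ^ 4], against [n ^ 3] from the inverse gap. With [J] of
    order [n] the surplus factor [n] is the source of the logarithm. *)
Lemma wilson_lower_bound (sigma : R) (J t : nat) :
  (4 < n)%N -> beta <= 1 / 2 ->
  0 < sigma -> (0 < J)%N -> (2 * J <= k)%N -> (4 * k <= 3 * n)%N ->
  (forall j, (J <= j < 2 * J)%N -> sigma <= sin (pi / n%:R * j%:R)) ->
  max_dist (exclusion n k beta) t < 1 / 4 ->
  sigma ^+ 2 * J%:R ^+ 4 / 48 <=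
    n%:R ^+ 3 * expR (18 * beta * n%:R) * expR (4 * gap n beta * t%:R).
Proof.
move=> n4 b2 s0 J0 J2k k34 sinJ dt; have [b0 b1] := andP beta01.
have l1 := odds_gt1 beta01; have n0 : 0 < n%:R :> R by rewrite ltr0n ltnW.
have p0 := predn_gt0 R n_gt1; have /andP[g_ge g_le] := edge_gap_bounds.
have n5 : 5 <= n%:R :> R by rewrite ler_nat.
have pn : n.-1%:R = n%:R - 1 :> R by rewrite -subn1 natrB // ltnW.
have gap_ge : 2 / n%:R ^+ 3 <= gap n beta.
  rewrite /gap ler_pdivlMr //; apply: le_trans g_ge.
  have -> : 2 / n%:R ^+ 3 * n.-1%:R = 2 / n%:R ^+ 2 * (n.-1%:R / n%:R) :> R.
    by field; rewrite gt_eqF.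
  by rewrite ler_piMr ?divr_ge0 ?exprn_ge0 // ler_pdivrMr // mul1r pn; lra.
have gap_gt0 : 0 < gap n beta by apply: lt_le_trans gap_ge; rewrite divr_gt0 ?exprn_gt0.
have gap_le : gap n beta <= 1 / 2.
  rewrite /gap ler_pdivrMr //; apply: le_trans g_le _.
  have : 8 / n%:R ^+ 2 <= 1 :> R by rewrite ler_pdivrMr ?exprn_gt0 //; nra.
  by rewrite pn; nra.
have ex_stat : exists mu, is_stationary (exclusion n k beta) mu.
  by eexists; apply: gibbs_stationary.
pose Phi (c : config n k) := eigenfun k beta (val c).
have eigen c : evolve (exclusion n k beta) Phi c = (1 - gap n beta) * Phi c.
  by rewrite (evolve_exclusion beta (eigenfun k beta)) gen_eigenfun // cnt_config.
have second c : evolve (exclusion n k beta) (fun c => Phi c ^+ 2) c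
    <= (1 - gap n beta *+ 2) * Phi c ^+ 2 + jump n beta ^+ 2.
  rewrite (evolve_exclusion beta (fun s => eigenfun k beta s ^+ 2)).
  by rewrite gen_eigenfun_sqr // cnt_config.
have gap01 : 0 < gap n beta <= 1 / 2 by rewrite gap_gt0 gap_le.
have := wilson (fun c c' => exclusion_ge0 c c' beta01) (exclusion_sum1 (k := k) beta n_gt1)
  (left_config k_le) ex_stat gap01 (sqr_ge0 _) eigen second dt.
have Phi0 := eigenfun_left_packed (ltW s0) J0 J2k k34 sinJ.
rewrite /Phi /= exprMn -exprM mulnC exprM.
set P0 := eigenfun _ _ _ in Phi0 *; set D := lam ^+ n in Phi0 *.
have D0 : 0 < D by rewrite exprn_gt0 // (lt_trans _ l1).
set A := sigma * J%:R ^+ 2 / 4 in Phi0.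
have A0 : 0 <= A by rewrite divr_ge0 // mulr_ge0 ?exprn_ge0 ?(ltW s0).
have lm0 : 0 < lam - 1 by rewrite subr_gt0.
have E_le : expR (- (4 * gap n beta * t%:R)) <= (1 - gap n beta) ^+ 2 ^+ t.
  have -> : - (4 * gap n beta * t%:R) = t%:R * (2%:R * (- (2 * gap n beta))) by ring.
  rewrite !expRM_natl; apply: lerXn2r; rewrite ?nnegrE ?exprn_ge0 ?expR_ge0 //; first by lra.
  apply: lerXn2r; rewrite ?nnegrE ?expR_ge0 //; first by lra.
  rewrite expRN -div1r ler_pdivrMr ?expR_gt0 //.
  have := expR_ge1Dx (2 * gap n beta); nra.
set E := expR (4 * _ * _); have E0 : 0 < E by apply: expR_gt0.
rewrite expRN -/E in E_le => wil.
(* Four powers of [D] come from the squared initial value and two from [jump ^+ 2]; [beta <= 1 / 2]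
   gives [odds <= exp (3 beta)]. *)
have D6 : D ^+ 6 <= expR (18 * beta * n%:R).
  have -> : 18 * beta * n%:R = n%:R * (6%:R * (3 * beta)) by ring.
  rewrite !expRM_natl /D -!exprM mulnC !exprM.
  apply: lerXn2r; rewrite ?nnegrE ?exprn_ge0 ?expR_ge0 ?(ltW (lt_trans ltr01 l1)) //.
  apply: lerXn2r; rewrite ?nnegrE ?expR_ge0 ?(ltW (lt_trans ltr01 l1)) //.
  rewrite -expRM_natl /odds ler_pdivrMr; last by lra.
  have e1 := expR_ge1Dx beta; have e2 := expR_ge1Dx (2 * beta).
  have -> : 3%:R * beta = beta + 2 * beta by ring.
  have e3 : 1 <= expR (2 * beta) * (1 - beta) by nra.
  by rewrite expRD -mulrA -[leLHS]mulr1; apply: ler_pM => //; lra.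
have main : E^-1 * (A * ((lam - 1) / D ^+ 2)) ^+ 2 <= 3 * n%:R ^+ 3 * (jump n beta) ^+ 2.
  apply: (@le_trans _ _ (6 * jump n beta ^+ 2 / gap n beta)); last first.
    rewrite ler_pdivrMr //; have j0 := sqr_ge0 (jump n beta).
    have : n%:R ^+ 3 * gap n beta >= 2.
      by rewrite mulrC -ler_pdivrMr ?exprn_gt0.
    by move=> h; nra.
  have X0 : 0 <= A * ((lam - 1) / D ^+ 2).
    by apply: mulr_ge0 => //; apply: divr_ge0; apply: ltW => //; apply: exprn_gt0.
  apply: le_trans wil; apply: ler_pM => //; first by rewrite invr_ge0 ltW.
    exact: sqr_ge0.
  by apply: lerXn2r; rewrite ?nnegrE // (le_trans X0).
have : A ^+ 2 <= 3 * n%:R ^+ 3 * D ^+ 6 * E.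
  have c0 : 0 < E^-1 * ((lam - 1) / D ^+ 2) ^+ 2.
    by rewrite mulr_gt0 ?invr_gt0 // exprn_gt0 // divr_gt0 // exprn_gt0.
  rewrite -(ler_pM2l c0).
  have -> : E^-1 * ((lam - 1) / D ^+ 2) ^+ 2 * A ^+ 2 = E^-1 * (A * ((lam - 1) / D ^+ 2)) ^+ 2.
    by ring.
  apply: le_trans main _; rewrite /jump -/D le_eqVlt; apply/orP; left; apply/eqP.
  by field; rewrite !gt_eqF.
have -> : sigma ^+ 2 * J%:R ^+ 4 / 48 = A ^+ 2 / 3 by rewrite /A; field.
have : n%:R ^+ 3 * D ^+ 6 * E <= n%:R ^+ 3 * expR (18 * beta * n%:R) * E.
  by rewrite ler_wpM2r ?(ltW E0) // ler_wpM2l ?exprn_ge0.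
by lra.
Qed.

End WilsonBound.

(** * Bounds on the mixing time at fixed size and bias *)

Section MixingTimeBounds.
Variables (R : realType) (n k : nat) (beta : R).
Hypotheses (n_gt4 : (4 < n)%N) (beta01 : 0 < beta < 1) (k_le : (k <= n)%N).

Let n_gt1 : (1 < n)%N. Proof. exact: leq_trans n_gt4. Qed.

(** The first conjunct excludes the default value of [tmix]: lower bounds valid at every time with
    distance below [1 / 4] then apply at the mixing time itself. The [+ 1] is rounding. *)
Lemma mixing_upper :
  let X := n%:R * (4 + 4 * ln n%:R + 4 * beta * n%:R) / delta n beta in
  max_dist (exclusion n k beta) (exclusion_tmix n k beta) < 1 / 4 /\
  (exclusion_tmix n k beta)%:R <= X + 1.
Proof.
move=> X; have [b0 b1] := andP beta01.
have n0 : 0 < n%:R :> R by rewrite ltr0n ltnW.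
have d0 : 0 < delta n beta.
  by rewrite /delta ltr_wpDl ?divr_ge0 ?sqr_ge0 // invr_gt0 exprn_gt0.
have X0 : 0 <= X.
  rewrite /X divr_ge0 ?(ltW d0) // mulr_ge0 // ?(ltW n0) //.
  have : 0 <= ln n%:R :> R by rewrite ln_ge0 // ler1n ltnW.
  have : 0 <= 4 * beta * n%:R by rewrite !mulr_ge0 // ltW.
  by lra.
have dt : max_dist (exclusion n k beta) (Num.truncn X).+1 < 1 / 4.
  apply: max_dist_lt => //; rewrite -ler_pdivrMr // ltW // -/X.
  exact: truncnS_gt.
split; first by apply: max_dist_tmix; exists (Num.truncn X).+1.
apply: (@le_trans _ _ (Num.truncn X).+1%:R); first by rewrite ler_nat tmix_le.
by rewrite -natr1 lerD2r; have /andP[] := truncn_itv X0.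
Qed.

Lemma ballistic_rate (rho : R) (t : nat) : 0 < rho <= 1 / 2 ->
  rho / 2 * n%:R <= k%:R -> (4 * k <= 3 * n)%N -> 1 <= n%:R * beta ->
  max_dist (exclusion n k beta) t < 1 / 4 -> rho ^+ 2 / 48 * n%:R ^+ 2 <= t%:R * beta.
Proof.
move=> /andP[r0 r1] rk k34 nb dt; have [b0 b1] := andP beta01.
have n0 : 0 < n%:R :> R by rewrite ltr0n ltnW.
have n5 : 5 <= n%:R :> R by rewrite ler_nat.
have := ballistic_lower_bound n_gt1 beta01 k_le (geq_minl k (n - k)) (geq_minr k (n - k)) dt.
set J : nat := minn _ _ => bal.
have rJ : rho / 2 * n%:R <= J%:R.
  rewrite /J; have [_|_] := leqP k (n - k); first by [].
  rewrite natrB //; have : (4 * k)%:R <= (3 * n)%:R :> R by rewrite ler_nat.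
  by rewrite !natrM; nra.
have J2 : (rho / 2 * n%:R) ^+ 2 <= J%:R ^+ 2.
  by apply: lerXn2r; rewrite ?nnegrE // mulr_ge0 ?divr_ge0 // ltW.
have pn : n.-1%:R = n%:R - 1 :> R by rewrite -subn1 natrB // ltnW.
have drift_le : drift n beta <= 3 / 2 * beta.
  have : (2 * n.-1%:R)^-1 <= beta.
    rewrite -div1r ler_pdivrMr; last by rewrite mulr_gt0 // predn_gt0.
    by rewrite pn; nra.
  by rewrite /drift; lra.
have : t%:R * drift n beta <= t%:R * (3 / 2 * beta) by rewrite ler_wpM2l.
by move: bal J2; rewrite exprMn; lra.
Qed.

Lemma gap_upper : gap n beta <= 2 / n%:R * (beta ^+ 2 + 8 / n%:R ^+ 2).
Proof.
have n0 : 0 < n%:R :> R by rewrite ltr0n ltnW.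
have n5 : 5 <= n%:R :> R by rewrite ler_nat.
have /andP[_ g_le] := edge_gap_bounds n_gt1 beta01.
have pn : n.-1%:R = n%:R - 1 :> R by rewrite -subn1 natrB // ltnW.
rewrite /gap ler_pdivrMr ?predn_gt0 //; apply: le_trans g_le _.
set y := beta ^+ 2 + _; have y0 : 0 <= y by rewrite addr_ge0 ?sqr_ge0 ?divr_ge0 ?exprn_ge0.
rewrite mulrAC ler_peMl // mulrAC ler_pdivlMr // pn; lra.
Qed.

(** Of [ln n], one half absorbs [exp (18 beta n) <= sqrt n] and a quarter absorbs the constant; the
    last quarter bounds [4 * gap * t] from below. *)
Lemma wilson_rate (rho sigma : R) (t : nat) : 0 < rho -> 0 < sigma ->
  (forall z, pi * (rho / 8) <= z <= pi * (3 / 4) -> sigma <= sin z) ->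
  rho / 2 * n%:R <= k%:R -> (4 * k <= 3 * n)%N -> 8 <= rho * n%:R ->
  36 * (n%:R * beta) <= ln n%:R ->
  - (4 * ln (sigma ^+ 2 * rho ^+ 4 / (8 ^+ 4 * 48))) <= ln n%:R ->
  max_dist (exclusion n k beta) t < 1 / 4 -> ln n%:R <= 16 * (gap n beta * t%:R).
Proof.
move=> r0 s0 sinP rk k34 rn nb lnn dt; have [b0 b1] := andP beta01.
have n0 : 0 < n%:R :> R by rewrite ltr0n ltnW.
have b2 : beta <= 1 / 2.
  have : ln n%:R <= n%:R :> R by apply: ltW; apply: ln_sublinear.
  by move=> h; nra.
(* For [J <= j < 2 J] the angle [pi j / n] then lies between [pi rho / 8] and [3 pi / 4]. *)
set J := k./2.
have J2k : (2 * J <= k)%N by rewrite mul2n -[leqRHS](odd_double_half k) leq_addl.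
have rJ : rho / 8 * n%:R <= J%:R.
  have : (k <= 2 * J + 1)%N.
    by rewrite -[leqLHS](odd_double_half k) mul2n addnC leq_add2l leq_b1.
  by rewrite -(ler_nat R) natrD natrM; lra.
have J0 : (0 < J)%N.
  by rewrite -(ltr_nat R); apply: lt_le_trans rJ; rewrite mulr_gt0 // divr_gt0.
have sinJ j : (J <= j < 2 * J)%N -> sigma <= sin (pi / n%:R * j%:R).
  move=> /andP[Jj jJ]; apply: sinP; rewrite mulrAC -mulrA.
  rewrite !ler_pM2l ?pi_gt0 //; apply/andP; split.
    rewrite ler_pdivlMr //; apply: le_trans rJ _; by rewrite ler_nat.
  rewrite ler_pdivrMr //; have : (4 * j)%:R <= (3 * n)%:R :> R.
    by rewrite ler_nat (leq_trans _ k34) // leq_mul2l /= (leq_trans (ltnW jJ)).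
  by rewrite !natrM; lra.
have := wilson_lower_bound n_gt1 beta01 k_le n_gt4 b2 s0 J0 J2k k34 sinJ dt.
set K := sigma ^+ 2 * rho ^+ 4 / (8 ^+ 4 * 48) in lnn; move=> wil.
have K0 : 0 < K by rewrite divr_gt0 // mulr_gt0 // exprn_gt0.
set l := ln n%:R in nb lnn *; have nE : n%:R = expR l :> R by rewrite /l lnK.
have Kn : K * n%:R <= expR (l / 2) * expR (4 * gap n beta * t%:R).
  have n30 : 0 < n%:R ^+ 3 :> R by rewrite exprn_gt0.
  rewrite -(ler_pM2l n30) mulrA [leRHS]mulrA; apply: (@le_trans _ _ (sigma ^+ 2 * J%:R ^+ 4 / 48)).
    have -> : n%:R ^+ 3 * K * n%:R = sigma ^+ 2 * (rho / 8 * n%:R) ^+ 4 / 48.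
      by rewrite /K; field.
    rewrite ler_wpM2r // ler_wpM2l ?sqr_ge0 //.
    by apply: lerXn2r; rewrite ?nnegrE // mulr_ge0 ?divr_ge0 // ltW.
  apply: le_trans wil _; rewrite ler_wpM2r ?expR_ge0 // ler_wpM2l ?(ltW n30) //.
  by rewrite ler_expR; lra.
have : ln K + l <= l / 2 + 4 * gap n beta * t%:R.
  rewrite -ler_expR !expRD -nE; apply: le_trans Kn.
  by rewrite (lnK (x := K)).
by lra.
Qed.

End MixingTimeBounds.

(** * Estimates that hold from some rank on *)

Section Uniformity.
Variables (R : realType) (rho : R) (k : nat -> nat).
Hypotheses (rho_gt0 : 0 < rho) (rho_le : rho <= 1 / 2).
Hypothesis k_density : ((k n)%:R / n%:R @[n --> \oo] --> rho).

Lemma near_ln_ge (C : R) : (\forall n \near \oo, C <= ln n%:R).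
Proof.
exists (Num.truncn (expR C)).+1 => // n /= Cn.
rewrite -[leLHS]expRK ler_ln ?posrE ?expR_gt0 //; last first.
  by rewrite ltr0n (leq_trans _ Cn).
by rewrite (le_trans (ltW (truncnS_gt _))) // ler_nat.
Qed.

Lemma near_density : (\forall n \near \oo,
  rho / 2 * n%:R <= (k n)%:R /\ (4 * k n <= 3 * n)%N).
Proof.
have n_gt0 : (\forall n \near \oo, (0 < n)%N) by exists 1%N.
have e1 : 0 < rho / 2 by rewrite divr_gt0.
have e2 : 0 < 1 / 4 :> R by [].
move/cvgrPdist_lt: k_density => kd; have := kd _ e1; have := kd _ e2.
apply: filterS3 n_gt0 => n n0; have n0' : 0 < n%:R :> R by rewrite ltr0n.
rewrite !ltr_norml => /andP[h1 h2] /andP[h3 h4]; split.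
  by rewrite -ler_pdivlMr //; lra.
rewrite -(ler_nat R) !natrM.
have rho2 : rho * 2 <= 1 by rewrite -ler_pdivlMr.
have : (k n)%:R / n%:R <= 3 / 4 :> R by lra.
by rewrite ler_pdivrMr //; lra.
Qed.

Lemma sin_lower_bound : exists2 sigma : R, 0 < sigma &
  forall z, pi * (rho / 8) <= z <= pi * (3 / 4) -> sigma <= sin z.
Proof.
have p0 := pi_gt0 R.
have rho2 : rho * 2 <= 1 by rewrite -ler_pdivlMr.
have ab : pi * (rho / 8) <= pi * (3 / 4) by rewrite ler_pM2l //; lra.
have [|c] := @EVT_min R sin _ _ ab.
  by apply: continuous_subspaceT; apply: continuous_sin.
rewrite in_itv /= => /andP[c1 c2] cmin; exists (sin c).
  have : 0 < pi * (rho / 8) by rewrite mulr_gt0 // divr_gt0.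
  by move=> h; apply: sin_gt0_pi; apply/andP; split; lra.
by move=> z zP; apply: cmin; rewrite in_itv.
Qed.

End Uniformity.

(** * The three regimes *)

Theorem theorem1 (R : realType) (rho : R) (k : nat -> nat)
    (rho_gt0 : 0 < rho) (rho_le : rho <= 1 / 2)
    (k_density : (k n)%:R / n%:R @[n --> \oo] --> rho) :
  [/\ asymp_on (fun n (beta : R) => 0 < beta < 1 /\ n%:R * beta <= 1)
        (fun n (beta : R) => (exclusion_tmix n (k n) beta)%:R)
        (fun n (beta : R) => n%:R ^+ 3 * ln n%:R),
      asymp_on (fun n (beta : R) => 0 < beta < 1 /\ 1 <= n%:R * beta <= ln n%:R)
        (fun n (beta : R) => (exclusion_tmix n (k n) beta)%:R)
        (fun n (beta : R) => n%:R * ln n%:R / beta ^+ 2) &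
      asymp_on (fun n (beta : R) => 0 < beta < 1 /\ n%:R * beta > ln n%:R)
        (fun n (beta : R) => (exclusion_tmix n (k n) beta)%:R)
        (fun n (beta : R) => n%:R ^+ 2 / beta)].
Proof.
have [sigma sigma_gt0 sinP] := sin_lower_bound rho_gt0 rho_le.
have rho01 : 0 < rho <= 1 / 2 by rewrite rho_gt0.
(* All requirements concern the rank alone, never [beta]. In the first regime [36 <= ln n] makes the
   threshold of [wil] automatic. *)
pose large n := [/\ (4 < n)%N, (k n <= n)%N, rho / 2 * n%:R <= (k n)%:R,
  (4 * k n <= 3 * n)%N & [/\ 8 <= rho * n%:R, 36 <= ln n%:R :> R &
    - (4 * ln (sigma ^+ 2 * rho ^+ 4 / (8 ^+ 4 * 48))) <= ln n%:R]].
have near_large : \forall n \near \oo, large n.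
  have h1 : \forall n \near \oo, (4 < n)%N by exists 5%N.
  have h2 : \forall n \near \oo, 8 <= rho * n%:R.
    exists (Num.truncn (8 / rho)).+1 => // n /= Cn.
    rewrite mulrC -ler_pdivrMr //.
    by rewrite (le_trans (ltW (truncnS_gt _))) // ler_nat.
  have h3 := near_density rho_gt0 rho_le k_density.
  have h4 := near_ln_ge 36.
  have h5 := near_ln_ge (- (4 * ln (sigma ^+ 2 * rho ^+ 4 / (8 ^+ 4 * 48)))).
  near=> n.
  have [rk k34] : rho / 2 * n%:R <= (k n)%:R /\ (4 * k n <= 3 * n)%N by near: n.
  have kn : (k n <= n)%N by lia.
  split=> //; first by near: n.
  by split; near: n.
have pos n : large n -> 0 < n%:R :> R by case=> n4 *; rewrite ltr0n (leq_trans _ n4).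
have upper n (beta c : R) : large n -> 0 < beta < 1 -> 0 < c -> c <= delta n beta ->
    (exclusion_tmix n (k n) beta)%:R * c <=
      n%:R * (4 + 4 * ln n%:R + 4 * beta * n%:R) + c.
  move=> ln_ b01 c0 cd; have n0 := pos _ ln_; have [n4 kn rk k34 [rn l36 lK]] := ln_.
  have [b0 b1] := andP b01; have [_ up] := mixing_upper n4 b01 kn.
  have := ler_wpM2r (ltW c0) up; rewrite mulrDl mul1r => up'.
  apply: le_trans up' _; rewrite lerD2r mulrAC ler_pdivrMr ?(lt_le_trans c0) //.
  rewrite ler_wpM2l // mulr_ge0 ?(ltW n0) // addr_ge0 ?addr_ge0 ?mulr_ge0 ?(ltW b0) ?(ltW n0) //.
  by rewrite (le_trans _ l36).
have wil n (beta : R) : large n -> 0 < beta < 1 -> 36 * (n%:R * beta) <= ln n%:R ->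
    n%:R * ln n%:R <=
      32 * (beta ^+ 2 + 8 / n%:R ^+ 2) * (exclusion_tmix n (k n) beta)%:R.
  move=> ln_ b01 nb; have n0 := pos _ ln_; have [n4 kn rk k34 [rn l36 lK]] := ln_.
  have [dt _] := mixing_upper n4 b01 kn.
  have := wilson_rate n4 b01 kn rho_gt0 sigma_gt0 sinP rk k34 rn nb lK dt.
  have := gap_upper n4 b01; set T := (exclusion_tmix _ _ _)%:R => g_le w.
  have T0 : 0 <= T by [].
  have gT : gap n beta * T <= 2 / n%:R * (beta ^+ 2 + 8 / n%:R ^+ 2) * T by rewrite ler_wpM2r.
  have : ln n%:R <= 32 / n%:R * (beta ^+ 2 + 8 / n%:R ^+ 2) * T.
    apply: le_trans w _; move: gT; set y := beta ^+ 2 + _.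
    have -> : 2 / n%:R * y * T = 2 * (y * T / n%:R) by ring.
    have -> : 32 / n%:R * y * T = 32 * (y * T / n%:R) by ring.
    by lra.
  move=> /(ler_wpM2l (ltW n0)) /le_trans; apply.
  by rewrite le_eqVlt; apply/orP; left; apply/eqP; field; rewrite gt_eqF.
have bal n (beta : R) : large n -> 0 < beta < 1 -> 1 <= n%:R * beta ->
    rho ^+ 2 / 48 * n%:R ^+ 2 <= (exclusion_tmix n (k n) beta)%:R * beta.
  move=> ln_ b01 nb; have [n4 kn rk k34 _] := ln_.
  have [dt _] := mixing_upper n4 b01 kn.
  exact: ballistic_rate rho01 rk k34 nb dt.
split.
(* [288 = 32 * (1 + 8)] by [n beta <= 1] in [wil]; [13] bounds [9 + 4 ln n] by [13 ln n], using
   [delta >= 1 / n ^ 2]. *)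
- exists (1 / 288), 13; split; [by rewrite divr_gt0 ?ltr01 ?ltr0n | by rewrite ltr0n |].
  apply: filterS near_large => n ln_ beta [b01 nb].
  have n0 := pos _ ln_; have [n4 kn rk k34 [rn l36 lK]] := ln_; have [b0 b1] := andP b01.
  have nb36 : 36 * (n%:R * beta) <= ln n%:R by lra.
  have n2 : 0 < n%:R ^+ 2 :> R by rewrite exprn_gt0.
  have n3 : 0 < n%:R ^+ 3 :> R by rewrite exprn_gt0.
  have l0 : 0 < ln n%:R :> R by lra.
  rewrite ler_pdivlMr ?mulr_gt0 // ler_pdivrMr ?mulr_gt0 //; apply/andP; split.
    have := wil _ _ ln_ b01 nb36; set T := (exclusion_tmix _ _ _)%:R => w.
    have T0 : 0 <= T by [].
    have bn : beta ^+ 2 * n%:R ^+ 2 <= 1 by rewrite -exprMn mulrC exprn_ile1 // mulr_ge0 // ltW.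
    have := ler_wpM2l (ltW n2) w.
    have -> : n%:R ^+ 2 * (n%:R * ln n%:R) = n%:R ^+ 3 * ln n%:R :> R by ring.
    have -> : n%:R ^+ 2 * (32 * (beta ^+ 2 + 8 / n%:R ^+ 2) * T) =
       32 * (beta ^+ 2 * n%:R ^+ 2 + 8) * T by field; rewrite gt_eqF.
    by nra.
  have c0 : 0 < n%:R ^- 2 :> R by rewrite invr_gt0.
  have cd : n%:R ^- 2 <= delta n beta by rewrite /delta lerDr divr_ge0 ?sqr_ge0.
  have := upper _ _ _ ln_ b01 c0 cd; rewrite -(ler_pM2l n2).
  set T := (exclusion_tmix _ _ _)%:R.
  have -> : n%:R ^+ 2 * (T * n%:R ^- 2) = T by field; rewrite gt_eqF.
  have -> : n%:R ^+ 2 * (n%:R * (4 + 4 * ln n%:R + 4 * beta * n%:R) + n%:R ^- 2) =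
    n%:R ^+ 3 * (4 + 4 * ln n%:R + 4 * (n%:R * beta)) + 1 by field; rewrite gt_eqF.
  have n31 : 1 <= n%:R ^+ 3 :> R by rewrite exprn_ege1 // ler1n (leq_trans _ n4).
  move=> /le_trans; apply.
  apply: (@le_trans _ _ (n%:R ^+ 3 * (4 + 4 * ln n%:R + 4) + n%:R ^+ 3)).
    by rewrite lerD // ler_pM2l // lerD2l; lra.
  by nra.
(* [288] comes from [wil] with [1 / n ^ 2 <= beta ^ 2], and [48 * 36] from [bal] when
   [n beta > ln n / 36]; [25 = 2 * 12 + 1], using [delta >= beta ^ 2 / 2]. *)
- exists (Num.min (1 / 288) (rho ^+ 2 / (48 * 36))), 25; split; [|by rewrite ltr0n|].
    by rewrite lt_min !divr_gt0 ?mulr_gt0 ?exprn_gt0 ?ltr01 ?ltr0n.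
  apply: filterS near_large => n ln_ beta [b01 /andP[nb1 nbl]].
  have n0 := pos _ ln_; have [n4 kn rk k34 [rn l36 lK]] := ln_; have [b0 b1] := andP b01.
  have l0 : 0 < ln n%:R :> R by lra.
  have bb0 : 0 < beta ^+ 2 by rewrite exprn_gt0.
  have n2 : 0 < n%:R ^+ 2 :> R by rewrite exprn_gt0.
  have nl0 : 0 < n%:R * ln n%:R / beta ^+ 2 by rewrite divr_gt0 ?mulr_gt0.
  rewrite ler_pdivlMr // ler_pdivrMr //; apply/andP; split.
    rewrite mulrA ler_pdivrMr //; set T := (exclusion_tmix _ _ _)%:R.
    have T0 : 0 <= T by [].
    have nl : 0 <= n%:R * ln n%:R :> R by rewrite mulr_ge0 // ltW.
    have [nb36|nb36] := leP (36 * (n%:R * beta)) (ln n%:R).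
      apply: (@le_trans _ _ (1 / 288 * (n%:R * ln n%:R))).
        by rewrite ler_wpM2r // ge_min lexx.
      have := wil _ _ ln_ b01 nb36; rewrite -/T.
      have : 8 / n%:R ^+ 2 <= 8 * beta ^+ 2.
        rewrite ler_pdivrMr // -mulrA -exprMn.
        have : 1 <= (n%:R * beta) ^+ 2 by rewrite exprn_ege1.
        by rewrite [beta * _]mulrC; lra.
      by nra.
    apply: (@le_trans _ _ (rho ^+ 2 / (48 * 36) * (n%:R * ln n%:R))).
      by rewrite ler_wpM2r // ge_min lexx orbT.
    have := bal _ _ ln_ b01 nb1; rewrite -/T => bT.
    have := ler_wpM2r (ltW b0) bT.
    have -> : T * beta * beta = T * beta ^+ 2 by ring.
    have rr : 0 <= rho ^+ 2 / 48 * n%:R by rewrite mulr_ge0 ?divr_ge0 ?sqr_ge0 ?(ltW n0).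
    have := ler_wpM2l rr (ltW nb36).
    have -> : rho ^+ 2 / 48 * n%:R * (36 * (n%:R * beta)) = 36 * (rho ^+ 2 / 48 * n%:R ^+ 2 * beta).
      by ring.
    have -> : rho ^+ 2 / (48 * 36) * (n%:R * ln n%:R) = rho ^+ 2 / 48 * n%:R * ln n%:R / 36.
      by field.
    by lra.
  have c0 : 0 < beta ^+ 2 / 2 by rewrite divr_gt0.
  have cd : beta ^+ 2 / 2 <= delta n beta by rewrite /delta lerDl invr_ge0 ltW.
  have := upper _ _ _ ln_ b01 c0 cd.
  set T := (exclusion_tmix _ _ _)%:R; rewrite [25 * _]mulrA ler_pdivlMr //.
  have nl : n%:R * (4 + 4 * ln n%:R + 4 * beta * n%:R) <= n%:R * (12 * ln n%:R).
    by rewrite ler_pM2l //; lra.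
  have : 1 <= n%:R * ln n%:R :> R.
    by rewrite -[leLHS]mulr1; apply: ler_pM => //; [rewrite ler1n (leq_trans _ n4) | lra].
  have : beta ^+ 2 <= 1 by rewrite exprn_ile1 // ltW.
  by lra.
(* Now [n beta] exceeds [ln n], so the factor [exp (4 beta n)] of the weights, rather than the power
   of [n], governs the upper bound. *)
- exists (rho ^+ 2 / 48), 25; split=> //; first by rewrite divr_gt0 ?exprn_gt0.
  apply: filterS near_large => n ln_ beta [b01 nb].
  have n0 := pos _ ln_; have [n4 kn rk k34 [rn l36 lK]] := ln_; have [b0 b1] := andP b01.
  have bb0 : 0 < beta ^+ 2 by rewrite exprn_gt0.
  have n2 : 0 < n%:R ^+ 2 :> R by rewrite exprn_gt0.
  have nb1 : 1 <= n%:R * beta by lra.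
  have n2b : 0 < n%:R ^+ 2 / beta by rewrite divr_gt0.
  rewrite ler_pdivlMr // ler_pdivrMr //; apply/andP; split.
    by rewrite mulrA ler_pdivrMr //; apply: bal.
  have c0 : 0 < beta ^+ 2 / 2 by rewrite divr_gt0.
  have cd : beta ^+ 2 / 2 <= delta n beta by rewrite /delta lerDl invr_ge0 ltW.
  have := upper _ _ _ ln_ b01 c0 cd.
  set T := (exclusion_tmix _ _ _)%:R; rewrite [25 * _]mulrA ler_pdivlMr // => up.
  have nl : n%:R * (4 + 4 * ln n%:R + 4 * beta * n%:R) <= n%:R * (12 * (n%:R * beta)).
    by rewrite ler_pM2l //; lra.
  have bn : beta ^+ 2 <= n%:R ^+ 2 * beta.
    rewrite expr2 ler_pM2r //; apply: (@le_trans _ _ 1); first exact: ltW.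
    by rewrite exprn_ege1 // ler1n (leq_trans _ n4).
  rewrite -(ler_pM2r b0).
  have -> : T * beta * beta = T * (beta ^+ 2 / 2) * 2 by field.
  have -> : 25 * n%:R ^+ 2 * beta = 2 * (n%:R * (12 * (n%:R * beta))) + n%:R ^+ 2 * beta by ring.
  by lra.
Unshelve. all: by end_near.
Qed.
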